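(* Let $X$ be an infinite compact metric space, let $T:X\to X$ be a homeomorphism such that $(X,T)$ is minimal, and let $(Z,S)$ be the maximal equicontinuous factor of $(X,T)$. Then the following are equivalent: (1) $(X,T)$ is mean equicontinuous; (2) $(X,T)$ is Weyl mean equicontinuous; (3) $(X,T)$ is an isomorphic extension of $(Z,S)$ (in particular, $(X,T)$ is then uniquely ergodic).
   Context: A topological dynamical system $(X,T)$ is a homeomorphism $T$ of a compact metric space $X$ with metric $d$. It is minimal if every orbit is dense, and uniquely ergodic if it has exactly one $T$-invariant Borel probability measure. A topological factor map $\pi:(X,T)\to(Z,S)$ is a continuous surjection $\pi:X\to Z$ with $\pi\circ T=S\circ\pi$. The maximal equicontinuous factor is the largest topological factor of $(X,T)$ that is equicontinuous; it may be finite (even trivial). The Besicovitch and Weyl distances between points $x,y\in X$ are $$d_{\mathsf B}(x,y)=\limsup_{n\to\infty}\frac1n\sum_{i=0}^{n-1}d(T^ix,T^iy),\qquad d_{\mathsf W}(x,y)=\limsup_{n-m\to\infty}\frac1{n-m}\sum_{i=m}^{n-1}d(T^ix,T^iy),$$ where in the second formula $0\le m<n$ and the limsup means $\lim_{N\to\infty}\sup\{\cdot : n-m\ge N\}$. The system $(X,T)$ is mean equicontinuous if for every $\epsilon>0$ there is $\delta>0$ such that for all $x,y\in X$, $d(x,y)<\delta$ implies $d_{\mathsf B}(x,y)<\epsilon$. It is Weyl mean equicontinuous if for every $\epsilon>0$ there is $\delta>0$ such that for all $x,y\in X$, $d(x,y)<\delta$ implies $d_{\mathsf W}(x,y)<\epsilon$.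 $(X,T)$ is an isomorphic extension of $(Z,S)$ if $(X,T)$ is uniquely ergodic (with unique invariant measure $\mu$; then $(Z,S)$ is uniquely ergodic too, with unique invariant measure $\nu$) and there exists a topological factor map $\pi:X\to Z$ which is at the same time a measure-theoretic isomorphism between $(X,\mu,T)$ and $(Z,\nu,S)$, where the sigma-algebras are the Borel sigma-algebras completed with respect to the measures (i.e. $\pi$ becomes a bimeasurable bijection after discarding a null set in $X$ and a null set in $Z$). *)

(* Defs.v *)
From HB Require Import structures.
From mathcomp Require Import all_boot all_order all_algebra.
From mathcomp Require Import all_classical all_reals all_analysis.
From mathcomp Require Import measurable_realfun.

Set Implicit Arguments.
Unset Strict Implicit.
Unset Printing Implicit Defensive.
Import Order.TTheory GRing.Theory Num.Theory.

Local Open Scope classical_set_scope.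
Local Open Scope ring_scope.

(* Measurable types are pointed in MathComp-Analysis, so Borel sigma-algebras
   are put on nonempty metric spaces; the chosen point plays no other role. *)
#[short(type="pmetricType")]
HB.structure Definition PointedMetric (K : numDomainType) :=
  {M of Pointed M & Metric K M}.

Notation borel X := (g_sigma_algebraType (@open X)).

Record homeo (X : topologicalType) := Homeo {
  homeo_fun :> X -> X;
  homeo_inv : X -> X;
  homeo_cts : continuous homeo_fun;
  homeo_inv_cts : continuous homeo_inv;
  homeo_funK : cancel homeo_fun homeo_inv;
  homeo_invK : cancel homeo_inv homeo_fun }.

Definition ziter (X : topologicalType) (T : homeo X) (n : int) : X -> X :=
  match n with
  | Posz k => iter k T
  | Negz k => iter k.+1 (homeo_inv T)
  end.

Definition minimal (X : topologicalType) (T : homeo X) : Prop :=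
  forall x : X, dense (range (fun n : int => ziter T n x)).

(* On a compact space the pointwise and the uniform notions of
   equicontinuity of the family of powers coincide. *)
Definition equicontinuous_system (X : puniformType) (T : homeo X) : Prop :=
  equicontinuous [set: int] (ziter T).

Definition factor_map (X Z : topologicalType) (T : homeo X) (S : homeo Z)
    (p : X -> Z) : Prop :=
  [/\ continuous p, range p = [set: Z] & p \o T = S \o p].

(* The largest equicontinuous factor: every equicontinuous factor map of
   (X, T) factors through the one onto (Z, S). *)
Definition maximal_equicontinuous_factor (R : realType) (X Z : pmetricType R)
    (T : homeo X) (S : homeo Z) : Prop :=
  [/\ compact [set: Z], equicontinuous_system S &
    exists2 p : X -> Z, factor_map T S p &
      forall (W : pmetricType R) (U : homeo W) (q : X -> W),
        compact [set: W] -> equicontinuous_system U -> factor_map T U q ->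
        exists2 r : Z -> W, factor_map S U r & q = r \o p].

Section mean_equicontinuity.
Variables (R : realType) (X : metricType R) (T : homeo X).

Definition mean_dist (x y : X) (m n : nat) : R :=
  (n - m)%:R^-1 * \sum_(m <= i < n) mdist (iter i T x) (iter i T y).

Definition besicovitch_dist (x y : X) : \bar R :=
  limn_esup (fun n => (mean_dist x y 0 n)%:E).

Definition weyl_dist (x y : X) : \bar R :=
  limn (fun N : nat => ereal_sup
    [set (mean_dist x y mn.1 mn.2)%:E |
      mn in [set mn : nat * nat | (mn.1 < mn.2)%N /\ (N <= mn.2 - mn.1)%N]]).

Definition mean_equicontinuous : Prop :=
  forall e : R, 0 < e -> exists2 d : R, 0 < d &
    forall x y : X, mdist x y < d -> (besicovitch_dist x y < e%:E)%E.

Definition weyl_mean_equicontinuous : Prop :=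
  forall e : R, 0 < e -> exists2 d : R, 0 < d &
    forall x y : X, mdist x y < d -> (weyl_dist x y < e%:E)%E.

End mean_equicontinuity.

Definition invariant_measure (R : realType) (X : pmetricType R) (T : homeo X)
    (mu : probability (borel X) R) : Prop :=
  forall A : set (borel X), measurable A -> mu (T @^-1` A) = mu A.

(* Uniqueness is equality on Borel sets: a measure is a function on all
   subsets, with unspecified values outside of the sigma-algebra. *)
Definition unique_invariant_measure (R : realType) (X : pmetricType R)
    (T : homeo X) (mu : probability (borel X) R) : Prop :=
  invariant_measure T mu /\
  forall mu' : probability (borel X) R, invariant_measure T mu' ->
    forall A : set (borel X), measurable A -> mu' A = mu A.

(* [completed_algebra_gen mu] is the completion of the sigma-algebra with
   respect to [mu].  Preservation of the measure on Borel sets determines it on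
   the completions.  Equivariance is not repeated here: it is part of
   [factor_map]. *)
Definition measure_isomorphism (R : realType) (X Z : pmetricType R)
    (mu : probability (borel X) R) (nu : probability (borel Z) R)
    (p : X -> Z) : Prop :=
  (forall B : set (borel Z), measurable B -> mu (p @^-1` B) = nu B) /\
  exists (X0 : set (borel X)) (Z0 : set (borel Z)),
    [/\ mu.-negligible (~` X0), nu.-negligible (~` Z0), set_bij X0 Z0 p,
        forall B : set (borel Z), B `<=` Z0 ->
          completed_algebra_gen nu B ->
          completed_algebra_gen mu (X0 `&` p @^-1` B) &
        forall A : set (borel X), A `<=` X0 ->
          completed_algebra_gen mu A -> completed_algebra_gen nu (p @` A)].

Definition isomorphic_extension (R : realType) (X Z : pmetricType R)
    (T : homeo X) (S : homeo Z) : Prop :=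
  exists (mu : probability (borel X) R) (nu : probability (borel Z) R),
    [/\ unique_invariant_measure T mu, unique_invariant_measure S nu &
        exists2 p : X -> Z, factor_map T S p & measure_isomorphism mu nu p].

(* Main.v *)
Require Import Defs.
From HB Require Import structures.
From mathcomp Require Import all_boot all_order all_algebra.
From mathcomp Require Import all_classical all_reals all_analysis.
From mathcomp Require Import measurable_realfun lra.

(** The two notions of mean equicontinuity concern averages of distances along
    orbits, the third condition is measure theoretic; the bridge is that all the
    averages involved can be integrated against invariant measures.

    Mean equicontinuity gives an isomorphic extension. By mean equicontinuity
    the Besicovitch distance is a continuous pseudodistance, and it is invariant
    under [T]. The quotient by it is a system of isometries, hence an
    equicontinuous factor ([besicovitch_factor]), hence a factor of [Z]: the
    Besicovitch distance of [x] and [y] depends only, and continuously, on [p x]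
    and [p y], where [p] is the projection to [Z]. Choose a step function [s] on
    [Z] with values in [X] such that [s (p x)] is Besicovitch-close to [x] for
    all [x] ([besicovitch_section]). Integrating over an invariant measure [mu],
    the mean over [i] of the integrals of [d (T^i x, T^i (s (p x)))] is small,
    so one of these integrals is; by invariance it is the integral of [d (x, s'
    (p x))] for the step function [s' = T^i s S^-i] ([factor_section]). With a
    sequence of such step functions whose errors are summable, [x] is for almost
    every [x] the limit of values that depend only on [p x], so [p] is injective
    off a null set ([factor_injective_off_null]). A continuous map of this kind
    on a compact space is an isomorphism of measure spaces
    ([injective_off_null_isomorphism]). Unique ergodicity, of [X] and also of
    [Z], is easier: by minimality and mean equicontinuity the averages of a
    Lipschitz function along any two orbits are asymptotic
    ([mean_equicontinuous_uniquely_ergodic]).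

    An isomorphic extension is Weyl mean equicontinuous. As [p] is an
    isomorphism, every continuous function on [X] is close in mean to a
    continuous function of [p] ([continuous_lift]). Apply this to the distances
    to the points of a finite net. By unique ergodicity the averages of the
    error are small over every long window, uniformly in the point
    ([uniform_avg]), whereas the functions of [p] vary little between
    neighbouring orbits because [S] is equicontinuous
    ([isomorphic_extension_weyl]).

    That Weyl mean equicontinuity implies mean equicontinuity is a comparison of
    two upper limits.

    Existence of invariant measures, and the uniform averages just used, rest on
    limits of empirical measures ([empirical_limit]): a limit of averages along
    an ultrafilter is a positive linear functional, which is turned into a
    measure by the Riesz representation theorem ([riesz_representation]). *)

Set Implicit Arguments.
Unset Strict Implicit.
Unset Printing Implicit Defensive.
Import Order.TTheory GRing.Theory Num.Theory.
Import numFieldNormedType.Exports.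
Local Open Scope classical_set_scope.
Local Open Scope ring_scope.

(** * Bounded measurable functions *)

Section bounded_measurable.
Context d (T : measurableType d) (R : realType).
Implicit Types f g : T -> R.

(** For a probability these functions are integrable, so the real-valued
    integral is linear and monotone on them without further side conditions. *)
Definition bounded_measurable f :=
  measurable_fun [set: T] f /\ exists M, forall x, `|f x| <= M.

Lemma bounded_measurable_cst (c : R) : bounded_measurable (fun=> c).
Proof. by split; [exact: measurable_cst|exists `|c|]. Qed.

Lemma bounded_measurableD f g : bounded_measurable f -> bounded_measurable g ->
  bounded_measurable (fun x => f x + g x).
Proof.
move=> [mf [M fM]] [mg [N gN]]; split; first exact: measurable_funD.
by exists (M + N) => x; rewrite (le_trans (ler_normD _ _))// lerD.
Qed.

Lemma bounded_measurableN f : bounded_measurable f ->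
  bounded_measurable (fun x => - f x).
Proof.
move=> [mf [M fM]]; split; first exact: measurableT_comp.
by exists M => x; rewrite normrN.
Qed.

Lemma bounded_measurableB f g : bounded_measurable f -> bounded_measurable g ->
  bounded_measurable (fun x => f x - g x).
Proof. by move=> bf bg; apply/bounded_measurableD/bounded_measurableN. Qed.

Lemma bounded_measurableM (c : R) f : bounded_measurable f ->
  bounded_measurable (fun x => c * f x).
Proof.
move=> [mf [M fM]]; split; first exact: measurable_funM.
by exists (`|c| * M) => x; rewrite normrM ler_wpM2l.
Qed.

Lemma bounded_measurable_norm f : bounded_measurable f ->
  bounded_measurable (fun x => `|f x|).
Proof.
move=> [mf [M fM]]; split; first exact: measurableT_comp.
by exists M => x; rewrite normr_id.
Qed.

Lemma bounded_measurable_max f g : bounded_measurable f ->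
  bounded_measurable g -> bounded_measurable (fun x => Num.max (f x) (g x)).
Proof.
move=> [mf [M fM]] [mg [N gN]]; split; first exact: measurable_maxr.
exists (Num.max M N) => x; rewrite le_max /Num.max.
by case: ifPn => _; rewrite ?fM ?gN ?orbT.
Qed.

Lemma bounded_measurable_sum I (r : seq I) (f : I -> T -> R) :
  (forall i, bounded_measurable (f i)) ->
  bounded_measurable (fun x => \sum_(i <- r) f i x).
Proof.
move=> bf; elim: r => [|i r ih].
  by under eq_fun do rewrite big_nil; exact: bounded_measurable_cst.
by under eq_fun do rewrite big_cons; exact: bounded_measurableD.
Qed.

Lemma bounded_measurable_indic (A : set T) : measurable A ->
  bounded_measurable (\1_A : T -> R).
Proof.
move=> mA; split; first exact: measurable_indic.
by exists 1 => x; rewrite indicE; case: (x \in A); rewrite ?normr1 ?normr0.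
Qed.

Variable mu : probability T R.

Lemma bounded_measurable_integrable f : bounded_measurable f ->
  mu.-integrable [set: T] (EFin \o f).
Proof.
move=> [mf [M fM]]; apply: measurable_bounded_integrable => //.
  by rewrite -ge0_fin_numE// fin_num_measure.
exists M; split; first exact: num_real.
by move=> N MN x _; rewrite /= (le_trans (fM x))// ltW.
Qed.
Local Notation bi := bounded_measurable_integrable.

Lemma RintD f g : bounded_measurable f -> bounded_measurable g ->
  \int[mu]_x (f x + g x) = \int[mu]_x f x + \int[mu]_x g x.
Proof. by move=> bf bg; apply: RintegralD => //; exact: bi. Qed.

Lemma RintB f g : bounded_measurable f -> bounded_measurable g ->
  \int[mu]_x (f x - g x) = \int[mu]_x f x - \int[mu]_x g x.
Proof. by move=> bf bg; apply: RintegralB => //; exact: bi. Qed.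

Lemma RintM (c : R) f : bounded_measurable f ->
  \int[mu]_x (c * f x) = c * \int[mu]_x f x.
Proof. by move=> bf; apply: RintegralZl => //; exact: bi. Qed.

Lemma Rint_cst (c : R) : \int[mu]_x c = c.
Proof.
rewrite Rintegral_cst//.
by rewrite [X in fine X](@probability_setT _ _ _ mu)/= mulr1.
Qed.

Lemma le_Rint f g : bounded_measurable f -> bounded_measurable g ->
  (forall x, f x <= g x) -> \int[mu]_x f x <= \int[mu]_x g x.
Proof. by move=> bf bg fg; apply: le_Rintegral => //; exact: bi. Qed.

Lemma Rint_indic (A : set T) : measurable A ->
  \int[mu]_x (\1_A x : R) = fine (mu A).
Proof. by move=> mA; rewrite /Rintegral integral_indic// setIT. Qed.

Lemma Rint_sum I (r : seq I) (f : I -> T -> R) :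
  (forall i, bounded_measurable (f i)) ->
  \int[mu]_x (\sum_(i <- r) f i x) = \sum_(i <- r) \int[mu]_x f i x.
Proof.
move=> bf; elim: r => [|i r ih].
  by under eq_Rintegral do rewrite big_nil; rewrite Rint_cst big_nil.
rewrite big_cons -ih -RintD//; last exact: bounded_measurable_sum.
by apply: eq_Rintegral => x _; rewrite big_cons.
Qed.

Lemma Rint_ae0 f (N : set T) : bounded_measurable f -> mu.-negligible N ->
  (forall x, ~ N x -> f x = 0) -> \int[mu]_x f x = 0.
Proof.
move=> bf nN f0; rewrite /Rintegral (@ae_eq_integral _ _ _ mu _ (cst 0%E))//.
- by rewrite integral0.
- by apply/measurable_EFinP; case: bf.
- apply: negligibleS nN => x /=.
  by apply: contra_notP => Nx _; rewrite f0.
Qed.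

(** Bounded convergence: a constant is integrable for a probability, and so
    dominates. *)
Lemma cvg_Rint (f_ : nat -> T -> R) f (M : R) :
  (forall n, measurable_fun [set: T] (f_ n)) ->
  (forall n x, `|f_ n x| <= M) ->
  (forall x, f_ ^~ x @ \oo --> f x) ->
  (fun n => \int[mu]_x f_ n x) @ \oo --> \int[mu]_x f x.
Proof.
move=> mf fM cf.
have bn n : bounded_measurable (f_ n) by split => //; exists M => x.
have := @dominated_cvg _ _ _ mu setT measurableT (fun n => EFin \o f_ n)
  (EFin \o f) (cst M%:E).
have mE n : measurable_fun setT (EFin \o f_ n) by apply/measurable_EFinP.
have cE x : setT x -> (EFin \o f_ n) x @[n --> \oo] --> (EFin \o f) x.
  by move=> _; apply: cvg_EFin; [exact: nearW|exact: cf].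
have iM : mu.-integrable setT (cst M%:E).
  exact: (bi (bounded_measurable_cst M)).
move=> /(_ mE cE (fun=> fun=> isT) iM).
have leM n x : setT x -> (`|(EFin \o f_ n) x| <= cst M%:E x)%E.
  by move=> _; rewrite /= lee_fin.
move=> /(_ leM) H; rewrite /Rintegral.
apply: fine_cvg; rewrite fineK//.
have bf : bounded_measurable f.
  split; first exact: (measurable_fun_cvg mf (fun x _ => cf x)).
  exists M => x; rewrite -(cvg_lim _ (cvg_norm (cf x)))//.
  by apply: limr_le; [apply/cvg_ex; eexists;
    exact: cvg_norm (cf x)|exact: nearW].
exact: integrable_fin_num (bi bf).
Qed.

End bounded_measurable.

(** * Lipschitz functions and Borel sets of a metric space *)

Lemma continuous_sum_ord (R : realType) (X : topologicalType)
    (F : nat -> X -> R) n : (forall i, continuous (F i)) ->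
  continuous (fun x => \sum_(i < n) F i x).
Proof.
move=> cF; elim: n => [|n ih] x.
  by under eq_fun do rewrite big_ord0; exact: cvg_cst.
by under eq_fun do rewrite big_ord_recr/=; apply: cvgD; [exact: ih|exact: cF].
Qed.

Lemma continuous_iter (X : topologicalType) (f : X -> X) n : continuous f ->
  continuous (iter n f).
Proof.
move=> cf; elim: n => [|n ih] x /=; first exact: cvg_id.
by apply: continuous_comp; [exact: ih|exact: cf].
Qed.

Section metric_functions.
Context (R : realType).
Implicit Types X Y : metricType R.

Lemma near_mdistP X (P : set X) (x : X) :
  (\forall y \near x, P y) <->
  exists2 e : R, 0 < e & forall y, mdist x y < e -> P y.
Proof.
split=> [/nbhs_ballP[e /= e0 eP]|[e e0 eP]].
  by exists e => // y xy; apply: eP; rewrite ballEmdist.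
by apply/nbhs_ballP; exists e => //= y; rewrite ballEmdist/=; exact: eP.
Qed.

Lemma continuous_mdistP X Y (f : X -> Y) : continuous f <->
  forall x (e : R), 0 < e -> exists2 d : R, 0 < d &
    forall y, mdist x y < d -> mdist (f x) (f y) < e.
Proof.
split=> [cf x e e0|H x].
  have /nbhs_ballP[d /= d0 dP] : nbhs x (f @^-1` ball (f x) e).
    by apply: cf; exact: nbhsx_ballx.
  exists d => // y xy; have := dP y.
  by rewrite !ballEmdist/=; exact.
move=> A /near_mdistP[e e0 eA]; apply/near_mdistP.
by have [d d0 dP] := H x e e0; exists d => // y /dP; exact: eA.
Qed.

Lemma continuous_realP X (f : X -> R) : continuous f <->
  forall x (e : R), 0 < e -> exists2 d : R, 0 < d &
    forall y, mdist x y < d -> `|f x - f y| < e.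
Proof.
split=> [cf x e e0|H x].
  apply/near_mdistP; move: (cf x) => /cvgrPdist_lt; exact.
by apply/cvgrPdist_lt => e e0; apply/near_mdistP; exact: H.
Qed.

Definition lipschitz_with X (k : R) (f : X -> R) :=
  forall x y, `|f x - f y| <= k * mdist x y.

Lemma lipschitz_with_continuous X (k : R) (f : X -> R) :
  lipschitz_with k f -> continuous f.
Proof.
move=> lf; apply/continuous_realP => x e e0.
have k1 : 0 < `|k| + 1 by rewrite ltr_wpDl.
exists (e / (`|k| + 1)) => [|y]; first exact: divr_gt0.
rewrite ltr_pdivlMr// => xy; apply: le_lt_trans (lf _ _) _.
apply: le_lt_trans xy; rewrite mulrC ler_wpM2l ?mdist_ge0//.
by rewrite (le_trans (ler_norm _))// lerDl.
Qed.

Lemma lipschitz_with_mdist X (a : X) : lipschitz_with 1 (mdist a).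
Proof.
move=> x y; rewrite mul1r ler_norml; apply/andP; split.
  rewrite lerNl opprB lerBlDr addrC; exact: metric_triangle.
by rewrite lerBlDr addrC (metric_sym x y); exact: metric_triangle.
Qed.

(** The distance to [A] truncated at [1], so that it is meaningful also when
    [A] is empty. *)
Definition cdist X (A : set X) (x : X) : R :=
  inf (1 |` [set mdist x a | a in A]).

Lemma cdist_lbound X (A : set X) x : has_lbound (1 |` [set mdist x a | a in A]).
Proof. by exists 0 => _ [->|[a _ <-]]; rewrite ?ler01 ?mdist_ge0. Qed.

Lemma cdist_ge0 X (A : set X) x : 0 <= cdist A x.
Proof.
apply: lb_le_inf; first by exists 1; left.
by move=> _ [->|[a _ <-]]; rewrite ?ler01 ?mdist_ge0.
Qed.

Lemma cdist_le1 X (A : set X) x : cdist A x <= 1.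
Proof. by apply: ge_inf; [exact: cdist_lbound|left]. Qed.

Lemma cdist_le X (A : set X) x a : A a -> cdist A x <= mdist x a.
Proof. by move=> Aa; apply: ge_inf; [exact: cdist_lbound|right; exists a]. Qed.

Lemma cdist0 X (A : set X) x : A x -> cdist A x = 0.
Proof.
move=> Ax; apply/eqP; rewrite eq_le cdist_ge0 andbT.
by rewrite -(mdistxx x) cdist_le.
Qed.

Lemma cdist_triangle X (A : set X) x y : cdist A x <= mdist x y + cdist A y.
Proof.
rewrite -lerBlDl; apply: lb_le_inf; first by exists 1; left.
move=> _ [->|[a Aa <-]].
  by rewrite lerBlDl (le_trans (cdist_le1 _ _))// lerDr mdist_ge0.
by rewrite lerBlDl (le_trans (cdist_le x Aa))// metric_triangle.
Qed.

Lemma lipschitz_with_cdist X (A : set X) : lipschitz_with 1 (cdist A).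
Proof.
move=> x y; rewrite mul1r ler_norml; apply/andP; split.
  by rewrite lerNl opprB lerBlDr metric_sym cdist_triangle.
by rewrite lerBlDr cdist_triangle.
Qed.

Lemma cdist_gt0 X (A : set X) x : closed A -> ~ A x -> 0 < cdist A x.
Proof.
move=> cA Ax; have : open (~` A) by rewrite openC.
rewrite openE => /(_ x Ax) /near_mdistP[e e0 eA].
apply: (@lt_le_trans _ _ (Num.min 1 e)); first by rewrite lt_min ltr01.
apply: lb_le_inf; first by exists 1; left.
move=> _ [->|[a Aa <-]]; first by rewrite ge_min lexx.
rewrite ge_min; apply/orP; right; rewrite leNgt.
by apply/negP => /eA; exact.
Qed.

(** As [k] grows these functions increase to the indicator of [U], when [U] is
    open. *)
Definition bump X (U : set X) (k : nat) (x : X) : R :=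
  Num.min 1 (k%:R * cdist (~` U) x).

Lemma bump_ge0 X (U : set X) k x : 0 <= bump U k x.
Proof. by rewrite le_min ler01 mulr_ge0// cdist_ge0. Qed.

Lemma bump_le1 X (U : set X) k x : bump U k x <= 1.
Proof. by rewrite ge_min lexx. Qed.

Lemma bump_out X (U : set X) k x : ~ U x -> bump U k x = 0.
Proof. by move=> Ux; rewrite /bump cdist0// mulr0; apply/min_idPr. Qed.

Lemma bump_eq1 X (U : set X) k x (c : R) : 0 < c -> c <= cdist (~` U) x ->
  c^-1 <= k%:R -> bump U k x = 1.
Proof.
move=> c0 cx ck; apply/min_idPl; rewrite -[leLHS](mulVf (lt0r_neq0 c0)).
by apply: ler_pM => //; rewrite ?invr_ge0; exact: ltW.
Qed.

(** Hence the integrals of Lipschitz functions, which are the ones accessible to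
    mean distances, determine the measure of open sets. *)
Lemma lipschitz_with_bump X (U : set X) k : lipschitz_with k%:R (bump U k).
Proof.
move=> x y.
have minP (a b : R) : `|Num.min 1 a - Num.min 1 b| <= `|a - b|.
  have ab := ler_norm (a - b); have := ler_norm (b - a); rewrite distrC => ba.
  by rewrite /Num.min; case: ltP => ?; case: ltP => ?;
    rewrite ler_norml; apply/andP; split; lra.
apply: le_trans (minP _ _) _; rewrite -mulrBr normrM ger0_norm//.
by rewrite ler_wpM2l// -[leRHS]mul1r lipschitz_with_cdist.
Qed.

Lemma bump_cvg X (U : set X) x : open U ->
  bump U ^~ x @ \oo --> (\1_U x : R).
Proof.
move=> oU; have [Ux|Ux] := pselect (U x); last first.
  rewrite indicE memNset//.
  by under eq_cvg do rewrite bump_out//; exact: cvg_cst.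
have c0 : 0 < cdist (~` U) x by apply: cdist_gt0; [exact: open_closedC|exact].
rewrite indicE mem_set//; apply: cvg_near_cst.
near=> k; apply: (bump_eq1 c0) => //.
near: k; exact: nbhs_infty_ger.
Unshelve. all: by end_near. Qed.

End metric_functions.

Section borel.
Context (R : realType).

Lemma open_borel (X : pmetricType R) (U : set X) : open U ->
  measurable (U : set (borel X)).
Proof. exact: sub_sigma_algebra. Qed.

Lemma closed_borel (X : pmetricType R) (U : set X) : closed U ->
  measurable (U : set (borel X)).
Proof.
move=> cU; rewrite -[U]setCK; apply: measurableC; apply: open_borel.
by rewrite openC.
Qed.

Lemma continuous_borel (X Z : pmetricType R) (p : X -> Z) : continuous p ->
  measurable_fun [set: borel X] (p : borel X -> borel Z).
Proof.
move=> /continuousP cp;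
  apply: (@measurability _ _ (borel X) (borel Z) setT p (@open Z)) => //.
by move=> _ [U oU <-]; rewrite setTI; apply: open_borel; exact: cp.
Qed.

Lemma borel_preimage (X Z : pmetricType R) (p : X -> Z) : continuous p ->
  forall B : set (borel Z), measurable B ->
    measurable (p @^-1` B : set (borel X)).
Proof.
by move=> cp B mB; rewrite -[X in measurable X]setTI; apply: continuous_borel.
Qed.

Lemma continuous_measurable_real (X : pmetricType R) (f : X -> R) :
  continuous f -> measurable_fun [set: borel X] (f : borel X -> R).
Proof.
move=> /continuousP cf; apply: (measurability _ (RGenOpens.measurableE R)).
move=> _ [_ [a [b ->] <-]]; rewrite setTI; apply: open_borel.
exact/cf/interval_open.
Qed.

Lemma continuous_bounded (X : pmetricType R) (f : X -> R) :
  compact [set: X] -> continuous f ->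
  exists2 M : R, 0 < M & forall x, `|f x| <= M.
Proof.
move=> cX cf.
have : compact (f @` [set: X]).
  by apply: continuous_compact => //; apply: continuous_subspaceT => x.
move=> /compact_bounded[M [_ HM]]; exists (Num.max 1 (M + 1)).
  by rewrite lt_max ltr01.
move=> x; apply: (HM (Num.max 1 (M + 1))); last by exists x.
by rewrite lt_max ltrDl ltr01 orbT.
Qed.

Lemma continuous_bounded_measurable (X : pmetricType R) (f : X -> R) :
  compact [set: X] -> continuous f ->
  @bounded_measurable _ (borel X) R f.
Proof.
move=> cX cf; split; first exact: continuous_measurable_real.
by have [M _ fM] := continuous_bounded cX cf; exists M.
Qed.

End borel.

(** * The Riesz representation theorem on a compact metric space *)

(** Counting the levels below [s] recovers [s] up to 1; this compares a function
    with the sum of the indicators of its superlevel sets. *)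
Lemma count_below (R : realType) (s : R) m : 0 <= s ->
  Num.min m%:R s <= \sum_(k < m) (k%:R < s)%R%:R <= Num.min m%:R (s + 1).
Proof.
move=> s0; elim: m => [|m /andP[ih1 ih2]].
  by rewrite big_ord0 le_min lexx addr_ge0// andbT ge_min lexx.
have m0 : 0 <= m%:R :> R by [].
rewrite big_ord_recr/= -natr1; move: ih1 ih2.
move: (\sum_(k < m) _) => t; rewrite le_min => ih1 /andP[ih2 ih3].
case: (ltP m%:R s) ih1 => ms ih1; rewrite ?mulr1n ?mulr0n.
  by rewrite le_min ge_min; lra.
by rewrite addr0 le_min ge_min; lra.
Qed.

Section riesz.
Context (R : realType) (X : pmetricType R).
Variable L : (X -> R) -> R.
Hypothesis X_compact : compact [set: X].
Hypothesis L_linear : forall (c : R) (f g : X -> R),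
  continuous f -> continuous g ->
  L (fun x => c * f x + g x) = c * L f + L g.
Hypothesis L_mono : forall f g : X -> R, continuous f -> continuous g ->
  (forall x, f x <= g x) -> L f <= L g.
Hypothesis L1 : L (fun=> 1) = 1.

Let c_cst (c : R) : continuous (fun _ : X => c).
Proof. exact: cst_continuous. Qed.

Let cD (f g : X -> R) : continuous f -> continuous g ->
  continuous (fun x => f x + g x).
Proof. by move=> cf cg x; apply: cvgD; [exact: cf|exact: cg]. Qed.

Let cM (c : R) (f : X -> R) : continuous f -> continuous (fun x => c * f x).
Proof. by move=> cf x; apply: cvgM; [exact: cvg_cst|exact: cf]. Qed.

Let cmin (f g : X -> R) : continuous f -> continuous g ->
  continuous (fun x => Num.min (f x) (g x)).
Proof. by move=> cf cg x; apply: continuous_min; [exact: cf|exact: cg]. Qed.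

Let cmax (f g : X -> R) : continuous f -> continuous g ->
  continuous (fun x => Num.max (f x) (g x)).
Proof. by move=> cf cg x; apply: continuous_max; [exact: cf|exact: cg]. Qed.

Let L0 : L (fun=> 0) = 0.
Proof.
have := @L_linear (-1) _ _ (@c_cst 1) (@c_cst 1).
by rewrite L1 mulN1r addNr.
Qed.

Let LD (f g : X -> R) : continuous f -> continuous g ->
  L (fun x => f x + g x) = L f + L g.
Proof.
move=> cf cg; have := L_linear 1 cf cg; rewrite mul1r => <-.
by congr L; apply/funext => x; rewrite /= mul1r.
Qed.

Let LM c (f : X -> R) : continuous f -> L (fun x => c * f x) = c * L f.
Proof.
move=> cf; have := L_linear c cf (@c_cst 0); rewrite L0 addr0 => <-.
by congr L; apply/funext => x; rewrite addr0.
Qed.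

Let LC c : L (fun=> c) = c.
Proof.
rewrite -[RHS]mulr1 -L1 -LM; last exact: c_cst.
by congr L; apply/funext => x; rewrite mulr1.
Qed.

Let Lsum (F : nat -> X -> R) n : (forall i, continuous (F i)) ->
  L (fun x => \sum_(i < n) F i x) = \sum_(i < n) L (F i).
Proof.
move=> c_F; elim: n => [|n ih].
  by under eq_fun do rewrite big_ord0; rewrite L0 big_ord0.
under eq_fun do rewrite big_ord_recr/=.
by rewrite LD ?ih ?big_ord_recr//; exact: continuous_sum_ord.
Qed.

(** The functions whose values of [L] approximate from below the measure that
    an open set [U] is to have. *)
Definition subordinate (U : set X) (f : X -> R) :=
  [/\ continuous f, forall x, 0 <= f x <= 1 & forall x, ~ U x -> f x = 0].

Definition open_content (U : set X) : R := sup [set L f | f in subordinate U].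

Let sub0 U : subordinate U (fun=> 0).
Proof. by split => // x; rewrite lexx ler01. Qed.

Let sub_bump U k : subordinate U (bump U k).
Proof.
split; first exact: (lipschitz_with_continuous (@lipschitz_with_bump _ _ U k)).
  by move=> x; rewrite bump_ge0 bump_le1.
exact: bump_out.
Qed.

Let content_nonempty U : [set L f | f in subordinate U] !=set0.
Proof. by exists (L (fun=> 0)); exists (fun=> 0) => //; exact: sub0. Qed.

Let content_ubound U : has_ubound [set L f | f in subordinate U].
Proof.
exists 1 => _ [f [cf f01 _] <-]; rewrite -L1; apply: L_mono => //.
by move=> x; case/andP: (f01 x).
Qed.

Let content_ge U f : subordinate U f -> L f <= open_content U.
Proof. by move=> sf; apply: ub_le_sup; [exact: content_ubound|exists f]. Qed.

Let content_le U c : (forall f, subordinate U f -> L f <= c) ->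
  open_content U <= c.
Proof.
move=> H; apply: ge_sup; first exact: content_nonempty.
by move=> _ [f sf <-]; exact: H.
Qed.

Let content_ge0 U : 0 <= open_content U.
Proof. by rewrite -L0; apply: content_ge; exact: sub0. Qed.

Let contentS U V : U `<=` V -> open_content U <= open_content V.
Proof.
move=> UV; apply: content_le => f [cf f01 fU]; apply: content_ge; split=> // x.
by move=> Vx; apply: fU => /UV.
Qed.

Let content0 : open_content set0 = 0.
Proof.
apply/eqP; rewrite eq_le content_ge0 andbT; apply: content_le => f [cf _ f0].
by rewrite (_ : f = fun=> 0) ?L0//; apply/funext => x; exact: f0.
Qed.

Let contentT : open_content setT = 1.
Proof.
apply/eqP; rewrite eq_le; apply/andP; split.
  apply: content_le => f [cf f01 _]; rewrite -L1; apply: L_mono => // x.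
  by case/andP: (f01 x).
by rewrite -L1; apply: content_ge; split => // x;
  rewrite ?ler01 ?lexx => // /(_ I).
Qed.

Let trunc (e : R) (f : X -> R) x := Num.max (f x - e) 0.

Let c_trunc e f : continuous f -> continuous (trunc e f).
Proof.
move=> cf; apply: (@cmax (fun x => f x - e) (fun=> 0)); last exact: c_cst.
by apply: (@cD f (fun=> - e)) => //; exact: c_cst.
Qed.

Let L_trunc e f : continuous f -> L f - e <= L (trunc e f).
Proof.
move=> cf; rewrite lerBlDr -[X in _ + X]LC -LD; [|exact: c_trunc|exact: c_cst].
apply: L_mono => [//||x].
  exact: (@cD (trunc e f) (fun=> e) (c_trunc cf) (@c_cst e)).
by rewrite -lerBlDr /trunc le_max lexx.
Qed.

(** Compactness enters here: on the compact set where [f] is at least [e],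
    finitely many of the bumps over the [U i] already add up to at least 1. *)
Let content_bigcup (U : nat -> set X) (f : X -> R) (e : R) :
  (forall i, open (U i)) -> 0 < e -> subordinate (\bigcup_i U i) f ->
  exists n, L f - e <= \sum_(i < n) open_content (U i).
Proof.
move=> oU e0 [cf f01 fU].
have K_compact : compact [set x | e <= f x].
  apply: (subclosed_compact _ X_compact) => //.
  by apply: (@preimage_closed _ _ f [set y | e <= y]) => //; exact: closed_ge.
have : \forall n \near \oo,
    [set x | e <= f x] `<=` [set x | 1 <= \sum_(i < n) bump (U i) n x].
  move/compact_near_coveringP : K_compact; apply => x /= efx.
  have [i _ Uix] : (\bigcup_i U i) x.
    by apply: contrapT => /fU fx0; move: efx; rewrite fx0 leNgt e0.
  pose c := cdist (~` U i) x.
  have c0 : 0 < c by apply: cdist_gt0; [exact: open_closedC|exact].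
  have c20 : 0 < c / 2 by exact: divr_gt0.
  exists ([set y | mdist x y < c / 2], [set n | (i < n)%N /\ (c / 2)^-1 <=
    n%:R]).
    split; first by apply/near_mdistP; exists (c / 2).
    apply: filterI; [exact: nbhs_infty_gt|exact: nbhs_infty_ger].
  move=> [y n] /= [xy [ltin cn]].
  rewrite (bigD1 (Ordinal ltin))//= (bump_eq1 c20)//.
    by rewrite lerDl sumr_ge0// => j _; exact: bump_ge0.
  have := cdist_triangle (~` U i) x y; rewrite -/c; move: xy; lra.
move=> [n _ /(_ n (leqnn n)) nP]; exists n.
apply: le_trans (L_trunc e cf) _.
have c_bump i : continuous (bump (U i) n) by case: (sub_bump (U i) n).
apply: (@le_trans _ _ (\sum_(i < n) L (bump (U i) n))); last first.
  by apply: ler_sum => i _; apply: content_ge; exact: sub_bump.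
rewrite -(@Lsum (fun i => bump (U i) n))//; apply: L_mono => [||x].
- exact: c_trunc.
- exact: (@continuous_sum_ord _ _ (fun i => bump (U i) n)).
- have s0 : 0 <= \sum_(i < n) bump (U i) n x.
    by apply: sumr_ge0 => i _; exact: bump_ge0.
  rewrite /trunc ge_max s0 andbT; case: (leP e (f x)) => efx.
    by have := nP x efx => /=; case/andP: (f01 x) => _; move: e0; lra.
  by move: s0 efx; lra.
Qed.

Definition riesz_outer (A : set X) : \bar R :=
  (inf [set open_content U | U in [set U | open U /\ A `<=` U]])%:E.

Let outer_lbound A :
  has_lbound [set open_content U | U in [set U | open U /\ A `<=` U]].
Proof. by exists 0 => _ [U _ <-]; exact: content_ge0. Qed.

Let outer_nonempty A :
  [set open_content U | U in [set U | open U /\ A `<=` U]] !=set0.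
Proof. by exists (open_content setT); exists setT; split=> //;
  exact: openT. Qed.

Let outer_le A U : open U -> A `<=` U ->
  (riesz_outer A <= (open_content U)%:E)%E.
Proof.
move=> oU AU; rewrite lee_fin; apply: ge_inf; first exact: outer_lbound.
by exists U.
Qed.

Let le_outer A c : (forall U, open U -> A `<=` U -> c <= open_content U) ->
  (c%:E <= riesz_outer A)%E.
Proof.
move=> H; rewrite lee_fin; apply: lb_le_inf; first exact: outer_nonempty.
by move=> _ [U [oU AU] <-]; exact: H.
Qed.

Let outer_open U : open U -> riesz_outer U = (open_content U)%:E.
Proof.
move=> oU; apply/eqP; rewrite eq_le outer_le//=.
by apply: le_outer => V _; exact: contentS.
Qed.

Let outer_adherent A (e : R) : 0 < e -> exists U, [/\ open U, A `<=` U &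
  ((open_content U)%:E <= riesz_outer A + e%:E)%E].
Proof.
move=> e0.
have /(inf_adherent e0)[_ [U [oU AU] <-] /ltW Ue] : has_inf
    [set open_content U | U in [set U | open U /\ A `<=` U]].
  by split; [exact: outer_nonempty|exact: outer_lbound].
by exists U; split => //; rewrite -EFinD lee_fin.
Qed.

Let outer0 : riesz_outer set0 = 0%E.
Proof. by rewrite outer_open ?content0//; exact: open0. Qed.

Let outer_ge0 A : (0 <= riesz_outer A)%E.
Proof. by apply: le_outer => U _ _; exact: content_ge0. Qed.

Let outer_sigma_subadditive A (F : nat -> set X) :
  A `<=` \bigcup_n F n ->
  (riesz_outer A <= \sum_(n <oo) riesz_outer (F n))%E.
Proof.
move=> AF; apply/lee_addgt0Pr => e e0.
have e20 n : 0 < e / 2 / (2 ^ n.+1)%:R :> R.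
  by rewrite !divr_gt0// ltr0n expn_gt0.
have /choice[U /all_and3[oU FU Ue]] n := outer_adherent (F n) (e20 n).
have oUU : open (\bigcup_n U n) by apply: bigcup_open => i _; exact: oU.
have AU : A `<=` \bigcup_n U n.
  by move=> x /AF[n _ Fx]; exists n => //; exact: FU.
apply: le_trans (outer_le oUU AU) _.
apply: (@le_trans _ _ (\sum_(n <oo) riesz_outer (F n) + (e / 2)%:E +
    (e / 2)%:E)%E); last by rewrite -addeA -EFinD -splitr.
rewrite -leeBlDr// -EFinB.
apply: (@le_trans _ _ (\sum_(n <oo) (open_content (U n))%:E)%E); last first.
  apply: le_trans; last apply: (@epsilon_trick _ (fun n => riesz_outer (F n))
      (e / 2) xpredT (fun n => outer_ge0 (F n))).
    by apply: lee_nneseries => n *; [rewrite lee_fin;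
      exact: content_ge0|exact: Ue].
  by rewrite ltW// divr_gt0.
have S0 : (0 <= \sum_(n <oo) (open_content (U n))%:E)%E.
  by apply: nneseries_ge0 => n _ _; rewrite lee_fin content_ge0.
have partial n : ((\sum_(i < n) open_content (U i))%:E <=
    \sum_(n <oo) (open_content (U n))%:E)%E.
  rewrite -sumEFin -(big_mkord xpredT (fun i => (open_content (U i))%:E)).
  by apply: nneseries_lim_ge => i _; rewrite lee_fin content_ge0.
case: (\sum_(n <oo) _)%E S0 partial => [s _ partial|_ _|//]; last first.
  by rewrite leey.
rewrite lee_fin lerBlDr; apply: content_le => f sf.
have e2 : 0 < e / 2 by exact: divr_gt0.
have [n nP] := content_bigcup oU e2 sf.
by have := partial n; rewrite lee_fin; move: nP; lra.
Qed.

HB.instance Definition _ := isSubsetOuterMeasure.Build R X riesz_outer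
  outer0 outer_ge0 (fun A F => @outer_sigma_subadditive A F).

(** A function subordinate to [V `&` U], cut off at a level [e > 0], vanishes
    near [V `\` U]; so it can be added to a function subordinate to a
    neighbourhood of [V `\` U] without exceeding 1. *)
Let content_split U V : open U -> open V ->
  ((open_content (V `&` U))%:E + riesz_outer (V `&` ~` U) <=
   (open_content V)%:E)%E.
Proof.
move=> oU oV; rewrite -EFinD lee_fin -lerBrDr; set o := inf _.
apply: content_le => f [cf f01 fVU].
apply/ler_addgt0Pr => e e0; rewrite -lerBlDr.
apply: le_trans (L_trunc e cf) _; rewrite lerBrDr -lerBrDl.
pose W := V `&` [set x | f x < e].
have oW : open W.
  apply: openI => //.
  by apply: (@open_comp _ _ f [set y | y < e]) => [x _|];
    [exact: cf|exact: open_lt].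
have VW : V `&` ~` U `<=` W.
  move=> x [Vx Ux]; split => //=; rewrite fVU//.
  by move=> [_ /Ux].
have : (o%:E <= (open_content W)%:E)%E by exact: outer_le.
rewrite lee_fin => /le_trans; apply; apply: content_le => g [cg g01 gW].
rewrite lerBrDl -LD//; last exact: c_trunc.
apply: content_ge; split=> [|x|x Vx].
- by apply: (@cD (trunc e f) g) => //; exact: c_trunc.
- have /andP[g0 g1] := g01 x; have /andP[f0 f1] := f01 x.
  rewrite /trunc; case: (ltP (f x) e) => efx.
    have -> : Num.max (f x - e) 0 = 0 by apply/max_idPr; rewrite subr_le0 ltW.
    by rewrite add0r.
  have -> : Num.max (f x - e) 0 = f x - e by apply/max_idPl; rewrite subr_ge0.
  have -> : g x = 0 by apply: gW => -[_] /=; rewrite ltNge efx.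
  by move: e0 efx f1; lra.
- rewrite gW; last by case.
  rewrite /trunc fVU; last by case.
  by rewrite sub0r addr0; apply/max_idPr; rewrite oppr_le0 ltW.
Qed.

Let open_caratheodory U : open U -> riesz_outer.-caratheodory U.
Proof.
move=> oU; apply: le_caratheodory_measurable => A.
apply: le_outer => V oV AV.
rewrite -lee_fin; apply: le_trans (content_split oU oV); rewrite EFinD.
rewrite -outer_open; last exact: openI.
by apply: leeD; apply: (le_outer_measure riesz_outer); exact: setSI.
Qed.

Let borel_caratheodory (A : set (borel X)) : measurable A ->
  riesz_outer.-cara.-measurable (A : set (caratheodory_type riesz_outer)).
Proof.
apply: smallest_sub; last by move=> U; exact: open_caratheodory.
exact: sigma_algebra_measurable.
Qed.

Definition riesz_measure (A : set (borel X)) : \bar R := riesz_outer A.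

Let riesz_measure0 : riesz_measure set0 = 0%E.
Proof. exact: outer0. Qed.

Let riesz_measure_ge0 A : (0 <= riesz_measure A)%E.
Proof. exact: outer_ge0. Qed.

Let riesz_measure_sigma_additive : semi_sigma_additive riesz_measure.
Proof.
move=> F mF tF mUF; apply: caratheodory_measure_sigma_additive => //.
- by move=> i; exact: borel_caratheodory.
- exact: borel_caratheodory.
Qed.

HB.instance Definition _ := isMeasure.Build _ _ _ riesz_measure
  riesz_measure0 riesz_measure_ge0 riesz_measure_sigma_additive.

Let riesz_measureT : riesz_measure setT = 1%E.
Proof.
by rewrite /riesz_measure outer_open ?contentT//; exact: openT.
Qed.

HB.instance Definition _ :=
  Measure_isProbability.Build _ _ _ riesz_measure riesz_measureT.

(** Layer cake: [N * f] is the sum over [k < N] of its part between the levels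
    [k] and [k + 1], which is subordinate to the open set [k < N * f]. *)
Let L_le_Rint (f : X -> R) : continuous f -> (forall x, 0 <= f x <= 1) ->
  L f <= \int[riesz_measure]_x f x.
Proof.
move=> cf f01; apply/ler_addgt0Pr => e e0.
have [n ne] : exists n, e^-1 <= n.+1%:R.
  have [n _ /(_ n (leqnn n)) /= nP] := nbhs_infty_ger e^-1.
  by exists n; rewrite (le_trans nP)// ler_nat.
set N := n.+1 in ne *.
pose layer k x := Num.min 1 (Num.max (N%:R * f x - k%:R) 0).
pose level k := [set x | k%:R < N%:R * f x].
have o_level k : open (level k).
  apply: (@open_comp _ _ (fun x => N%:R * f x) [set y | k%:R < y]).
    by move=> x _; exact: cM.
  exact: open_gt.
have c_layer k : continuous (layer k).
  apply: (@cmin (fun=> 1)); first exact: c_cst.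
  apply: (@cmax _ (fun=> 0)); last exact: c_cst.
  by apply: (@cD _ (fun=> - k%:R)); [exact: cM|exact: c_cst].
have sub_layer k : subordinate (level k) (layer k).
  split=> // x.
    by rewrite /layer ge_min lexx le_min ler01 le_max lexx orbT.
  move=> /negP; rewrite -leNgt => kx; rewrite /layer.
  have -> : Num.max (N%:R * f x - k%:R) 0 = 0 by apply/max_idPr;
    rewrite subr_le0.
  exact/min_idPr.
have sumE x m : \sum_(k < m) layer k x = Num.min m%:R (N%:R * f x).
  have /andP[f0 _] := f01 x.
  have t0 : 0 <= N%:R * f x by rewrite mulr_ge0.
  elim: m => [|m ih]; first by rewrite big_ord0; apply/esym/min_idPl.
  rewrite big_ord_recr/= ih /layer -natr1.
  move: t0 (ler0n R m); move: (N%:R * f x) (m%:R : R) => t a t0 a0.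
  case: (leP t a) => ta.
    have -> : Num.max (t - a) 0 = 0 by apply/max_idPr; lra.
    have -> : Num.min 1 0 = 0 :> R by apply/min_idPr.
    have -> : Num.min (a + 1) t = t by apply/min_idPr; lra.
    by rewrite addr0.
  have -> : Num.max (t - a) 0 = t - a by apply/max_idPl; lra.
  by rewrite addr_minr addrCA subrr addr0.
have bl k : @bounded_measurable _ (borel X) R (\1_(level k) : X -> R).
  by apply: bounded_measurable_indic; exact: open_borel.
have bf : @bounded_measurable _ (borel X) R f.
  exact: continuous_bounded_measurable.
have N0 : 0 < N%:R :> R by rewrite ltr0n.
rewrite -(ler_pM2l N0) -LM//.
have -> : (fun x => N%:R * f x) = (fun x => \sum_(k < N) layer k x).
  apply/funext => x; rewrite sumE; apply/esym/min_idPr.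
  by rewrite ler_piMr//; case/andP: (f01 x).
rewrite Lsum//.
apply: (@le_trans _ _ (\int[riesz_measure]_x (\sum_(k < N) \1_(level k) x))).
  rewrite Rint_sum//; apply: ler_sum => k _.
  rewrite Rint_indic; last exact: open_borel.
  rewrite (le_trans (content_ge (sub_layer k)))//.
  by rewrite -[leLHS]/(fine (open_content (level k))%:E) -outer_open.
apply: (@le_trans _ _ (\int[riesz_measure]_x (N%:R * f x + 1))).
  apply: le_Rint => [||x].
  - exact: bounded_measurable_sum.
  - apply: bounded_measurableD; first exact: bounded_measurableM.
    exact: bounded_measurable_cst.
  have /(count_below N)/andP[_] : 0 <= N%:R * f x.
    by rewrite mulr_ge0//; case/andP: (f01 x).
  rewrite le_min => /andP[_]; apply: le_trans.
  apply: ler_sum => k _;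
    rewrite indicE (_ : (x \in level k) = (k%:R < N%:R * f x))//.
  by apply/idP/idP; rewrite inE.
rewrite RintD; [|exact: bounded_measurableM|exact: bounded_measurable_cst].
rewrite RintM// Rint_cst mulrDr lerD2l.
by rewrite -ler_pdivrMr// mul1r.
Qed.

Lemma riesz_representation : exists mu : probability (borel X) R,
  forall f : X -> R, continuous f -> \int[mu]_x f x = L f.
Proof.
exists (riesz_measure : probability (borel X) R) => f cf.
have unit_case (g : X -> R) : continuous g -> (forall x, 0 <= g x <= 1) ->
    \int[riesz_measure]_x g x = L g.
  move=> cg g01; apply/eqP; rewrite eq_le L_le_Rint// andbT.
  have c1g : continuous (fun x => -1 * g x + 1).
    by apply: (@cD _ (fun=> 1)); [exact: cM|exact: c_cst].
  have bg : @bounded_measurable _ (borel X) R g.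
    exact: continuous_bounded_measurable.
  have := L_le_Rint c1g; rewrite (@L_linear _ g (fun=> 1) cg (@c_cst 1)) L1.
  rewrite RintD; [|exact: bounded_measurableM|exact: bounded_measurable_cst].
  rewrite RintM// Rint_cst => H.
  have {}H : -1 * L g + 1 <= -1 * \int[riesz_measure]_x g x + 1.
    by apply: H => x; have /andP[] := g01 x; lra.
  by move: H; lra.
have [M M0 fM] := continuous_bounded X_compact cf.
pose g x := (2 * M)^-1 * (f x + M).
have cg : continuous g.
  by apply: (@cM _ (fun x => f x + M)); apply: (@cD f (fun=> M)) => //;
    exact: c_cst.
have M2 : 0 < 2 * M by rewrite mulr_gt0.
have g01 x : 0 <= g x <= 1.
  have := fM x; rewrite ler_norml => /andP[f1 f2].
  rewrite /g mulrC divr_ge0/=; [|lra|exact: ltW].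
  by rewrite ler_pdivrMr//; lra.
have fE : f = (fun x => 2 * M * g x + - M).
  by apply/funext => x; rewrite /g mulrA divff ?lt0r_neq0// mul1r addrK.
have bg : @bounded_measurable _ (borel X) R g.
  exact: continuous_bounded_measurable.
rewrite {2}fE (@L_linear _ g (fun=> - M) cg (@c_cst _)).
rewrite LC -(unit_case _ cg g01).
have -> : \int[riesz_measure]_x f x = \int[riesz_measure]_x (2 * M * g x + - M).
  by apply: eq_Rintegral => x _; rewrite {1}fE.
rewrite RintD; [|exact: bounded_measurableM|exact: bounded_measurable_cst].
by rewrite (RintM _ _ bg) Rint_cst.
Qed.

End riesz.

(** * Image measures and invariance *)

Section pushforward.
Context d1 d2 (T1 : measurableType d1) (T2 : measurableType d2) (R : realType).
Variable mu : probability T1 R.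

Lemma pushforward_probability (p : T1 -> T2) : measurable_fun [set: T1] p ->
  exists nu : probability T2 R,
    forall B, measurable B -> mu (p @^-1` B) = nu B.
Proof.
move=> mp; pose q : {mfun T1 >-> T2} := HB.pack p (isMeasurableFun.Build _ _ _
  _ p mp).
by exists (distribution mu q).
Qed.

Lemma Rint_pushforward (p : T1 -> T2) (nu : probability T2 R) (h : T2 -> R) :
  measurable_fun [set: T1] p ->
  (forall B, measurable B -> mu (p @^-1` B) = nu B) ->
  bounded_measurable h ->
  \int[nu]_y h y = \int[mu]_x h (p x).
Proof.
move=> mp mupnu bh.
have bhp : bounded_measurable (h \o p).
  case: bh => mh [M hM]; split; first exact: measurableT_comp.
  by exists M => x; exact: hM.
rewrite /Rintegral -(preimage_setT p).
rewrite -[X in _ = fine X](@integral_pushforward _ _ _ _ _ p mp mu setT (EFin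
  \o h)) //.
- congr fine; apply: eq_measure_integral => /= B mB _.
  exact/esym/mupnu.
- by apply/measurable_EFinP; case: bh.
- by rewrite preimage_setT; exact: (bounded_measurable_integrable mu bhp).
Qed.

End pushforward.

Section determined_by_lipschitz.
Context (R : realType) (X : pmetricType R).

(** The bumps over an open set converge to its indicator, and the open sets
    form a generating family stable under intersection. *)
Lemma probability_eq_lipschitz (mu1 mu2 : probability (borel X) R) :
  (forall (k : R) (f : X -> R), lipschitz_with k f ->
    (forall x, 0 <= f x <= 1) -> \int[mu1]_x f x = \int[mu2]_x f x) ->
  forall A : set (borel X), measurable A -> mu1 A = mu2 A.
Proof.
move=> H; apply: (@measure_unique _ _ (borel X) (@open X) (fun=> setT)) => //.
- exact: openI.
- move=> _; exact: openT.
- by rewrite bigcup_const//; exists 0%N.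
- move=> U oU; suff E : fine (mu1 U) = fine (mu2 U).
    rewrite -[LHS]fineK ?fin_num_measure//; last exact: open_borel.
    rewrite -[RHS]fineK ?fin_num_measure//; last exact: open_borel.
    by rewrite E.
  have cvgU (mu : probability (borel X) R) :
      (fun k => \int[mu]_x bump U k x) @ \oo --> fine (mu U).
    rewrite -(Rint_indic mu (open_borel oU)).
    apply: (@cvg_Rint _ _ _ mu _ _ 1) => [k|k x|x].
    - apply: continuous_measurable_real.
      exact: (lipschitz_with_continuous (@lipschitz_with_bump _ _ U k)).
    - by rewrite ger0_norm ?bump_ge0 ?bump_le1.
    - exact: bump_cvg.
  have E : (fun k => \int[mu1]_x bump U k x) = (fun k => \int[mu2]_x bump U k
    x).
    apply/funext => k; apply: H; first exact: lipschitz_with_bump.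
    by move=> x; rewrite bump_ge0 bump_le1.
  have := cvgU mu1; rewrite E => /(cvg_lim (@Rhausdorff R)) <-.
  exact: (cvg_lim (@Rhausdorff R) (cvgU mu2)).
- by move=> _; apply: fin_num_fun_lty => //; exact: fin_num_measure.
Qed.

End determined_by_lipschitz.

Section invariance.
Context (R : realType) (X : pmetricType R) (T : homeo X).
Variable mu : probability (borel X) R.

Lemma invariant_Rint (f : X -> R) : invariant_measure T mu ->
  @bounded_measurable _ (borel X) R f ->
  \int[mu]_x f (T x) = \int[mu]_x f x.
Proof.
move=> muT bf; apply/esym/(@Rint_pushforward _ _ (borel X) (borel X) _ mu T mu
  f) => //.
exact: continuous_borel (@homeo_cts _ T).
Qed.

Lemma invariant_Rint_iter (f : X -> R) n : invariant_measure T mu ->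
  @bounded_measurable _ (borel X) R f ->
  \int[mu]_x f (iter n T x) = \int[mu]_x f x.
Proof.
move=> muT; elim: n f => [//|n ih] f bf.
rewrite -(invariant_Rint muT bf) -(ih (fun x => f (T x))).
  by [].
case: bf => mf [M fM]; split; last by exists M => x.
by apply: measurableT_comp mf _; exact: continuous_borel (@homeo_cts _ T).
Qed.

(** The image of [mu] under [T] is another probability with the same integrals
    of continuous functions. *)
Lemma Rint_invariant : compact [set: X] ->
  (forall f : X -> R, continuous f -> \int[mu]_x f (T x) = \int[mu]_x f x) ->
  invariant_measure T mu.
Proof.
move=> cX muT A mA.
have mT : measurable_fun [set: borel X] (T : borel X -> borel X).
  exact: continuous_borel (@homeo_cts _ T).
have [nu nuE] := @pushforward_probability _ _ (borel X) (borel X) _ mu T mT.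
rewrite nuE//; apply: probability_eq_lipschitz => // k f lf _.
have cf : continuous f by exact: lipschitz_with_continuous lf.
rewrite -(muT f cf); apply: Rint_pushforward => //.
exact: continuous_bounded_measurable.
Qed.

End invariance.

(** * Time averages and limits of empirical measures *)

Section averages.
Context (R : realType) (X : Type).
Implicit Types (T : X -> X) (f g : X -> R).

Definition avg T f (n : nat) (x : X) : R :=
  n%:R^-1 * \sum_(i < n) f (iter i T x).

Lemma avg_linear T (c : R) f g n x :
  avg T (fun y => c * f y + g y) n x = c * avg T f n x + avg T g n x.
Proof. by rewrite /avg big_split/= -mulr_sumr; lra. Qed.

Lemma le_avg T f g n x : (forall y, f y <= g y) -> avg T f n x <= avg T g n x.
Proof.
by move=> fg; rewrite ler_wpM2l ?invr_ge0//; apply: ler_sum => i _; exact: fg.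
Qed.

Lemma avg_cst T (c : R) n x : (0 < n)%N -> avg T (fun=> c) n x = c.
Proof.
move=> n0; rewrite /avg sumr_const card_ord -[c *+ n]mulr_natl mulKf//.
by rewrite pnatr_eq0 -lt0n.
Qed.

Lemma avg_norm T f n x : `|avg T f n x| <= avg T (fun y => `|f y|) n x.
Proof.
rewrite /avg normrM ger0_norm ?invr_ge0// ler_wpM2l ?invr_ge0//.
exact: ler_norm_sum.
Qed.

Lemma avg_bound T f (M : R) n x : 0 <= M -> (forall y, `|f y| <= M) ->
  `|avg T f n x| <= M.
Proof.
move=> M0 fM; case: n => [|n]; first by rewrite /avg invr0 mul0r normr0.
rewrite (le_trans (avg_norm _ _ _ _))// -[leRHS](avg_cst T M x (ltn0Sn n)).
exact: le_avg.
Qed.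

Lemma avg_shift T f n x :
  avg T f n (T x) - avg T f n x = n%:R^-1 * (f (iter n T x) - f x).
Proof.
rewrite /avg -mulrBr; congr (_ * _).
under eq_bigr do rewrite -iterSr.
case: n => [|n]; first by rewrite !big_ord0 !subrr.
by rewrite big_ord_recr [X in _ - X]big_ord_recl/= addrC opprD addrACA subrr
  addr0.
Qed.

Lemma avg_comp T f n x : avg T (fun y => f (T y)) n x = avg T f n (T x).
Proof. by rewrite /avg; under [in RHS]eq_bigr do rewrite -iterSr. Qed.

(** The two sums telescope: they differ by two terms only. *)
Lemma avg_shift_bound T f (M : R) n x : (forall y, `|f y| <= M) ->
  `|avg T f n (T x) - avg T f n x| <= 2 * M / n%:R.
Proof.
move=> fM; rewrite avg_shift normrM ger0_norm ?invr_ge0// mulrC.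
rewrite ler_wpM2r ?invr_ge0// (le_trans (ler_normB _ _))//.
by rewrite mulr2n mulrDl mul1r lerD.
Qed.

Lemma near_div_le (M e : R) : 0 < e ->
  \forall n \near \oo, M / n%:R <= e.
Proof.
move=> e0; near=> n.
rewrite ler_pdivrMr; last by rewrite ltr0n; near: n; exact: nbhs_infty_gt.
by rewrite mulrC -ler_pdivrMr//; near: n; exact: nbhs_infty_ger.
Unshelve. all: by end_near. Qed.

Lemma avg_shift_cvg T f (M : R) x : (forall y, `|f y| <= M) ->
  (fun n => avg T f n (T x) - avg T f n x) @ \oo --> (0 : R).
Proof.
move=> fM; apply/cvgr0Pnorm_le => e e0; near=> n.
rewrite (le_trans (avg_shift_bound _ _ _ fM))//.
by near: n; exact: near_div_le.
Unshelve. all: by end_near. Qed.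

End averages.

Section ultrafilter_limits.
Context (R : realType) (U : set_system nat) {U_ultra : UltraFilter U}.

(** A cluster point of [u] in the compact interval is a limit along an
    ultrafilter, which contains each set or its complement. *)
Lemma ultra_cvg_bounded (u : nat -> R) (M : R) : (forall k, `|u k| <= M) ->
  cvg (u @ U).
Proof.
move=> uM; have [|l [_ ul]] := @segment_compact R (- M) M (u @ U) _ _.
  apply: (@filterE _ U) => k; have := uM k.
  by rewrite /= in_itv/= ler_norml.
apply/cvg_ex; exists l; apply/cvgrPdist_lt => e e0.
have [//|UC] := in_ultra_setVsetC [set k | `|l - u k| < e] U_ultra.
have [y [/= y1 y2]] := ul [set y | ~ `|l - y| < e] (ball l e) UC
  (nbhsx_ballx _ _ e0).
by case: (y1 y2).
Qed.

End ultrafilter_limits.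

Section empirical_limits.
Context (R : realType) (X : pmetricType R) (T : homeo X).
Hypothesis X_compact : compact [set: X].

(** Weak-* limits of empirical measures: with an ultrafilter no subsequence has
    to be extracted. *)
Lemma empirical_limit (x_ : nat -> X) (n_ : nat -> nat) :
  (forall k, (k < n_ k)%N) ->
  exists2 mu : probability (borel X) R, invariant_measure T mu &
    forall (f : X -> R) (c : R), continuous f ->
      (forall k, c <= avg T f (n_ k) (x_ k)) -> c <= \int[mu]_x f x.
Proof.
move=> kn; have [U [UU ooU]] := ultraFilterLemma eventually_filter.
pose a (f : X -> R) k := avg T f (n_ k) (x_ k).
have a_cvg f : continuous f -> cvg (a f @ U).
  move=> cf; have [M M0 fM] := continuous_bounded X_compact cf.
  by apply: (@ultra_cvg_bounded _ _ UU _ M) => k; apply: avg_bound => //;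
    exact: ltW.
have [|||mu muE] := @riesz_representation R X (fun f => lim (a f @ U))
  X_compact.
- move=> c f g cf cg; apply: cvg_lim => //.
  under eq_cvg do rewrite /a avg_linear.
  apply: cvgD; [apply: cvgM; [exact: cvg_cst|]|]; exact: a_cvg.
- move=> f g cf cg fg; apply: ler_lim; [exact: a_cvg|exact: a_cvg|].
  by apply: filterE => k; exact: le_avg.
- apply: cvg_lim => //;
  under eq_cvg do rewrite /a avg_cst ?(leq_ltn_trans _ (kn _))//.
  exact: cvg_cst.
exists mu; last first.
  move=> f c cf cle; rewrite muE//; apply: limr_ge; first exact: a_cvg.
  exact: filterE.
apply: Rint_invariant => // f cf.
have cfT : continuous (fun x => f (T x)).
  by move=> x; apply: continuous_comp; [exact: homeo_cts|exact: cf].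
rewrite !muE//; apply/eqP; rewrite -subr_eq0; apply/eqP.
rewrite -limB; [|exact: a_cvg|exact: a_cvg]; apply: cvg_lim => //.
have [M M0 fM] := continuous_bounded X_compact cf.
apply/cvgr0Pnorm_le => e e0; apply: ooU.
near=> k; rewrite /= /a fctE (avg_comp T f).
rewrite (le_trans (avg_shift_bound _ _ _ fM))//.
apply: (@le_trans _ _ (2 * M / k%:R)); last by near: k; exact: near_div_le.
apply: ler_wpM2l; first by rewrite mulr_ge0// ltW.
rewrite lef_pV2 ?posrE ?ler_nat ?ltr0n//.
- exact: ltnW.
- exact: leq_ltn_trans (kn k).
- by near: k; exact: nbhs_infty_gt.
Unshelve. all: by end_near. Qed.

End empirical_limits.

(** * Unique ergodicity of minimal mean equicontinuous systems *)

Section mean_distance.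
Context (R : realType) (X : metricType R) (T : homeo X).
Implicit Types x y z : X.

Lemma mean_dist0E x y n :
  mean_dist T x y 0 n = n%:R^-1 * \sum_(i < n) mdist (iter i T x) (iter i T y).
Proof. by rewrite /mean_dist subn0 big_mkord. Qed.

Lemma besicovitch_lt_near x y (e : R) : (besicovitch_dist T x y < e%:E)%E ->
  \forall n \near \oo, mean_dist T x y 0 n < e.
Proof.
rewrite /besicovitch_dist /limn_esup /limf_esup => /ereal_inf_lt[_ [V ooV <-]]
  Ve.
apply: filterS ooV => n Vn; rewrite -lte_fin; apply: le_lt_trans Ve.
by apply: ereal_sup_ubound; exists n.
Qed.

Lemma besicovitch_le x y (e : R) :
  (\forall n \near \oo, mean_dist T x y 0 n <= e) ->
  (besicovitch_dist T x y <= e%:E)%E.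
Proof.
move=> xye; rewrite /besicovitch_dist /limn_esup /limf_esup.
apply: (@le_trans _ _ (ereal_sup [set (mean_dist T x y 0 n)%:E | n in
    [set n | mean_dist T x y 0 n <= e]])).
  by apply: ereal_inf_lbound; exists [set n | mean_dist T x y 0 n <= e].
by apply: ge_ereal_sup => _ [n /= ne <-]; rewrite lee_fin.
Qed.

Lemma avg_lipschitz (k : R) (h : X -> R) n x y : lipschitz_with k h ->
  `|avg T h n x - avg T h n y| <= k * mean_dist T x y 0 n.
Proof.
move=> lh; rewrite /avg -mulrBr -sumrB normrM ger0_norm ?invr_ge0//.
rewrite mean_dist0E mulrCA ler_wpM2l ?invr_ge0// mulr_sumr.
by rewrite (le_trans (ler_norm_sum _ _ _))//; apply: ler_sum => i _; exact: lh.
Qed.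

End mean_distance.

Section unique_ergodicity.
Context (R : realType) (X : pmetricType R) (T : homeo X).

Lemma minimal_near (x y : X) (d : R) : minimal T -> 0 < d ->
  exists j : int, mdist (ziter T j x) y < d.
Proof.
move=> Tmin d0; have := Tmin x (interior (ball y d)).
case=> [|| z [/interior_subset yz [j _ jz]]].
- by exists y; exact: nbhsx_ballx.
- exact: open_interior.
by exists j; move: yz; rewrite ballEmdist/= jz metric_sym.
Qed.

(** A shift by one step does not change the averages asymptotically, hence no
    fixed shift does, in either direction of time. *)
Lemma avg_ziter_cvg (h : X -> R) (M : R) (j : int) x :
  (forall y, `|h y| <= M) ->
  (fun n => avg T h n (ziter T j x) - avg T h n x) @ \oo --> (0 : R).
Proof.
move=> hM; case: j => k /=.
  elim: k => [|k ih] /=; first by under eq_cvg do rewrite subrr; exact: cvg_cst.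
  rewrite -[0]addr0.
  apply: cvg_trans (cvgD (avg_shift_cvg T (iter k T x) hM) ih).
  by apply: near_eq_cvg; apply: nearW => n /=; rewrite fctE addrA subrK.
rewrite -iterS; elim: k.+1 => [|{}k ih] /=.
  by under eq_cvg do rewrite subrr; exact: cvg_cst.
rewrite -[0]subr0; apply: cvg_trans
  (cvgB ih (avg_shift_cvg T (homeo_inv T (iter k (homeo_inv T) x)) hM)).
by apply: near_eq_cvg; apply: nearW => n /=; rewrite !fctE homeo_invK; lra.
Qed.

(** Under minimality, any two orbits come arbitrarily close up to a time shift;
    by mean equicontinuity the averages along them then stay close. *)
Lemma avg_asymptotic (k : R) (h : X -> R) x y : minimal T ->
  mean_equicontinuous T -> lipschitz_with k h -> (forall y, `|h y| <= 1) ->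
  (fun n => avg T h n y - avg T h n x) @ \oo --> (0 : R).
Proof.
move=> Tmin Tmean lh h1; apply/cvgr0Pnorm_le => e e0.
have k1 : 0 < `|k| + 1 by rewrite ltr_wpDl.
have e2 : 0 < e / 2 by exact: divr_gt0.
have [d d0 dP] := Tmean (e / 2 / (`|k| + 1)) (divr_gt0 e2 k1).
have [j jd] := minimal_near x y Tmin d0.
have Hd := besicovitch_lt_near (dP _ _ jd).
have /cvgr0Pnorm_le/(_ _ e2) Hj := avg_ziter_cvg j x h1.
near=> n.
have A : `|avg T h n (ziter T j x) - avg T h n x| <= e / 2 by near: n.
have B : `|avg T h n (ziter T j x) - avg T h n y| <= e / 2.
  rewrite (le_trans (avg_lipschitz T n _ _ lh))//.
  have m : mean_dist T (ziter T j x) y 0 n < e / 2 / (`|k| + 1) by near: n.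
  have m0 : 0 <= mean_dist T (ziter T j x) y 0 n.
    rewrite mean_dist0E mulr_ge0 ?invr_ge0// sumr_ge0// => i _;
      exact: mdist_ge0.
  move: m; rewrite ltr_pdivlMr// => /ltW; apply: le_trans.
  rewrite mulrC ler_wpM2l// (le_trans (ler_norm _))// lerDl//.
rewrite -(subrKA (avg T h n (ziter T j x))) (splitr e) addrC.
by rewrite (le_trans (ler_normD _ _))// lerD// distrC.
Unshelve. all: by end_near. Qed.

Lemma bounded_measurable_avg (h : X -> R) n :
  @bounded_measurable _ (borel X) R h ->
  @bounded_measurable _ (borel X) R (avg T h n).
Proof.
move=> bh; apply: bounded_measurableM; apply: bounded_measurable_sum => i.
case: bh => mh [M hM]; split; last by exists M => x.
apply: measurableT_comp mh _; apply: continuous_borel; apply: continuous_iter.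
exact: homeo_cts.
Qed.

Lemma Rint_avg (mu : probability (borel X) R) (h : X -> R) n :
  invariant_measure T mu -> (0 < n)%N ->
  @bounded_measurable _ (borel X) R h ->
  \int[mu]_x avg T h n x = \int[mu]_x h x.
Proof.
move=> muT n0 bh.
have bhi i : @bounded_measurable _ (borel X) R (fun x => h (iter i T x)).
  case: bh => mh [M hM]; split; last by exists M => x.
  apply: measurableT_comp mh _; apply: continuous_borel; apply: continuous_iter.
  exact: homeo_cts.
rewrite RintM; last by apply: bounded_measurable_sum => i; exact: bhi.
rewrite Rint_sum; last by move=> i; exact: bhi.
under eq_bigr do rewrite invariant_Rint_iter//.
rewrite sumr_const card_ord -[X in _ * X]mulr_natl mulKf//.
by rewrite pnatr_eq0 -lt0n.
Qed.

Hypothesis X_compact : compact [set: X].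

(** The averages of a Lipschitz function along all orbits are asymptotic to
    those along one orbit; integrating, the latter converge to the integral
    against every invariant measure, which is thus the same for all of them. *)
Lemma mean_equicontinuous_uniquely_ergodic : minimal T ->
  mean_equicontinuous T ->
  exists mu : probability (borel X) R, unique_invariant_measure T mu.
Proof.
move=> Tmin Tmean.
have [mu muT _] := @empirical_limit _ _ T X_compact (fun=> point) succn
  (fun k => ltnSn k).
exists mu; split => // mu' mu'T; apply: probability_eq_lipschitz => k h lh h01.
have h1 y : `|h y| <= 1 by have /andP[] := h01 y; move=> ? ?; rewrite ger0_norm.
have bh : @bounded_measurable _ (borel X) R h.
  apply: continuous_bounded_measurable => //.
  exact: lipschitz_with_continuous lh.
have lim (m : probability (borel X) R) : invariant_measure T m ->
    (fun n => avg T h n.+1 point) @ \oo --> \int[m]_x h x.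
  move=> mT.
  have c : (fun n => \int[m]_x (avg T h n.+1 x - avg T h n.+1 point)) @ \oo -->
      \int[m]_x (0 : R).
    apply: (@cvg_Rint _ _ _ m _ _ 2) => [n|n x|x].
    - apply: measurable_funB; last exact: measurable_cst.
      by case: (bounded_measurable_avg n.+1 bh).
    - rewrite (le_trans (ler_normB _ _))// mulr2n.
      by rewrite lerD// avg_bound.
    - rewrite (cvg_shiftS (fun n => avg T h n x - avg T h n point)).
      exact: (avg_asymptotic point x Tmin Tmean lh h1).
  have E n : \int[m]_x (avg T h n.+1 x - avg T h n.+1 point) =
      \int[m]_x h x - avg T h n.+1 point.
    rewrite RintB; [|exact: bounded_measurable_avg|exact:
      bounded_measurable_cst].
    by rewrite Rint_cst Rint_avg.
  move: c; under eq_cvg do rewrite E.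
  rewrite Rint_cst => c; have := cvgB (cvg_cst (\int[m]_x h x)) c.
  rewrite subr0; under eq_cvg do rewrite /= subKr; exact.
have := lim _ mu'T => /(cvg_lim (@Rhausdorff R)) <-.
exact: (cvg_lim (@Rhausdorff R) (lim _ muT)).
Qed.

End unique_ergodicity.

(** * Uniformity on compact spaces, factors, and Weyl averages *)

Section heine.
Context (R : realType) (X : metricType R).
Hypothesis X_compact : compact [set: X].

(** Heine's theorem for a family of relations [P e] that behave like being at
    distance less than [e]. In this form it applies at once to closeness of all
    iterates of a map. *)
Lemma heine_relation (P : R -> X -> X -> Prop) :
  (forall e x y, P e x y -> P e y x) ->
  (forall e x y z, P e x y -> P e y z -> P (e + e) x z) ->
  (forall (e : R) x, 0 < e ->
    exists2 d : R, 0 < d & forall y, mdist x y < d -> P e x y) ->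
  forall e : R, 0 < e ->
    exists2 d : R, 0 < d & forall x y, mdist x y < d -> P e x y.
Proof.
move=> Psym Ptri Ploc e e0; have e2 : 0 < e / 2 by exact: divr_gt0.
have : \forall d \near 0^'+,
    [set: X] `<=` [set x | forall y, mdist x y < d -> P e x y].
  move/compact_near_coveringP : X_compact; apply => x _ /=.
  have [c c0 cP] := Ploc _ x e2; have c2 : 0 < c / 2 by exact: divr_gt0.
  exists ([set x' | mdist x x' < c / 2], [set d | d < c / 2]).
    split; first by apply/near_mdistP; exists (c / 2).
    exact: nbhs_right_lt.
  move=> [x' d] /= [xx' dc] y x'y; rewrite (splitr e); apply: (Ptri _ _ x).
    by apply/Psym/cP; lra.
  by apply: cP; have := metric_triangle x x' y; lra.
move=> Hd; near (0 : R)^'+ => d.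
have dP : [set: X] `<=` [set x | forall y, mdist x y < d -> P e x y] by near: d.
by exists d => // x y; exact: dP.
Unshelve. all: by end_near. Qed.

Lemma heine_real (f : X -> R) : continuous f ->
  forall e : R, 0 < e -> exists2 d : R, 0 < d &
    forall x y, mdist x y < d -> `|f x - f y| < e.
Proof.
move=> cf; apply: (@heine_relation (fun e x y => `|f x - f y| < e)).
- by move=> e x y; rewrite distrC.
- by move=> e x y z xy yz; rewrite (le_lt_trans (ler_distD (f y) _ _))// ltrD.
- by move=> e x; move/continuous_realP : cf; exact.
Qed.

End heine.

Section equicontinuous_systems.
Context (R : realType) (Z : pmetricType R) (S : homeo Z).

Lemma equicontinuous_uniform : compact [set: Z] -> equicontinuous_system S ->
  forall e : R, 0 < e -> exists2 d : R, 0 < d &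
    forall x y, mdist x y < d -> forall n, mdist (iter n S x) (iter n S y) < e.
Proof.
move=> cZ Seq.
apply: (@heine_relation _ _ cZ
  (fun e x y => forall n, mdist (iter n S x) (iter n S y) < e)).
- by move=> e x y xy n; rewrite metric_sym.
- move=> e x y z xy yz n.
  by rewrite (le_lt_trans (metric_triangle _ (iter n S y) _))// ltrD.
- move=> e x e0; apply/near_mdistP.
  have entE : entourage [set ab : Z * Z | mdist ab.1 ab.2 < e].
    have := @entourage_ball R Z (PosNum e0); congr entourage.
    by apply/seteqP; split=> -[a b] /=; rewrite ballEmdist.
  by apply: filterS (Seq x _ entE) => y Sy n; exact: (Sy (Posz n) I).
Qed.

Lemma equicontinuous_mean_equicontinuous : compact [set: Z] ->
  equicontinuous_system S -> mean_equicontinuous S.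
Proof.
move=> cZ Seq e e0; have e2 : 0 < e / 2 by exact: divr_gt0.
have [d d0 dP] := equicontinuous_uniform cZ Seq e2; exists d => // x y xy.
apply: (@le_lt_trans _ _ (e / 2)%:E); last by rewrite lte_fin; lra.
apply: besicovitch_le; near=> n.
rewrite mean_dist0E -/(avg S _ n x) -(@avg_cst R Z S (e / 2) n x); last first.
  by near: n; exact: nbhs_infty_gt.
rewrite ler_wpM2l ?invr_ge0//; apply: ler_sum => i _.
by rewrite ltW// dP.
Unshelve. all: by end_near. Qed.

End equicontinuous_systems.

Section factors.
Context (R : realType) (X Z : pmetricType R) (T : homeo X) (S : homeo Z).
Variable p : X -> Z.
Hypothesis p_factor : factor_map T S p.

Lemma factorE x : p (T x) = S (p x).
Proof. by case: p_factor => _ _ /(congr1 (@^~ x)). Qed.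

Lemma factor_iter n x : p (iter n T x) = iter n S (p x).
Proof. by elim: n => //= n <-; exact: factorE. Qed.

Lemma factor_inv x : p (homeo_inv T x) = homeo_inv S (p x).
Proof. by rewrite -{2}(homeo_invK T x) factorE homeo_funK. Qed.

Lemma factor_ziter j x : p (ziter T j x) = ziter S j (p x).
Proof.
case: j => n /=; first exact: factor_iter.
by rewrite -!iterS; elim: n.+1 => //= m <-; exact: factor_inv.
Qed.

Lemma factor_minimal : minimal T -> minimal S.
Proof.
case: p_factor => cp rp _ Tmin z O [w Ow] oO.
have [x _ xz] : range p z by rewrite rp.
have [y _ yw] : range p w by rewrite rp.
have [||x' [Ox' [j _ jx']]] := Tmin x (p @^-1` O).
- by exists y; rewrite /= yw.
- by move/continuousP : cp; exact.
- by exists (p x'); split => //; exists j => //; rewrite -jx' factor_ziter xz.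
Qed.

End factors.

Section weyl.
Context (R : realType) (X : metricType R) (T : homeo X).

Let window_sup (x y : X) (N : nat) : \bar R := ereal_sup
  [set (mean_dist T x y mn.1 mn.2)%:E |
    mn in [set mn : nat * nat | (mn.1 < mn.2)%N /\ (N <= mn.2 - mn.1)%N]].

Let weyl_distE x y : weyl_dist T x y = ereal_inf (range (window_sup x y)).
Proof.
apply: cvg_lim => //; apply: ereal_nonincreasing_cvgn => M N MN.
apply: le_ereal_sup => _ [mn [? Nmn] <-]; exists mn => //.
by split => //; exact: leq_trans Nmn.
Qed.

(** The suprema over windows of length at least [N] decrease with [N], so their
    limit is an infimum, and a strict bound is attained at some [N]. *)
Lemma weyl_lt_mean (x y : X) (e : R) : (weyl_dist T x y < e%:E)%E ->
  exists N : nat, forall m n : nat, (m < n)%N -> (N <= n - m)%N ->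
    mean_dist T x y m n < e.
Proof.
rewrite weyl_distE => /ereal_inf_lt[_ [N _ <-] Ne].
exists N => m n mn Nmn; rewrite -lte_fin; apply: le_lt_trans Ne.
by apply: ereal_sup_ubound; exists (m, n).
Qed.

Lemma weyl_le (x y : X) (e : R) (N : nat) :
  (forall m n : nat, (m < n)%N -> (N <= n - m)%N -> mean_dist T x y m n <= e) ->
  (weyl_dist T x y <= e%:E)%E.
Proof.
move=> H; rewrite weyl_distE; apply: (@le_trans _ _ (window_sup x y N)).
  by apply: ereal_inf_lbound; exists N.
by apply: ge_ereal_sup => _ [[m n] /= [mn Nmn] <-]; rewrite lee_fin; exact: H.
Qed.

Lemma weyl_mean_equicontinuous_mean : weyl_mean_equicontinuous T ->
  mean_equicontinuous T.
Proof.
move=> Tw e e0; have e2 : 0 < e / 2 by exact: divr_gt0.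
have [d d0 dP] := Tw _ e2; exists d => // x y /dP/weyl_lt_mean[N NP].
apply: (@le_lt_trans _ _ (e / 2)%:E); last by rewrite lte_fin; lra.
apply: besicovitch_le; near=> n; rewrite ltW// NP ?subn0//.
  by near: n; exact: nbhs_infty_gt.
by near: n; exact: nbhs_infty_ge.
Unshelve. all: by end_near. Qed.

End weyl.

(** * The quotient by the Besicovitch distance *)

Record pseudodist (R : realType) (X : Type) := Pseudodist {
  pdist :> X -> X -> R;
  pdistxx : forall x, pdist x x = 0;
  pdistC : forall x y, pdist x y = pdist y x;
  pdist_triangle : forall y x z, pdist x z <= pdist x y + pdist y z }.

Section metric_quotient.
Context (R : realType) (X : pointedType) (e : pseudodist R X).

Definition pdist_repr (x : X) : X := get [set y | e x y = 0].

Lemma pdist_reprP x : e x (pdist_repr x) = 0.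
Proof. by apply: (@getPex _ [set y | e x y = 0]); exists x; exact: pdistxx. Qed.

Lemma pdist0_eq x x' y : e x x' = 0 -> e x y = e x' y.
Proof.
move=> xx'; have := pdist_triangle e x' x y; have := pdist_triangle e x x' y.
by rewrite (pdistC e x' x) xx'; lra.
Qed.

Lemma pdist_repr_eq x y : e x y = 0 -> pdist_repr x = pdist_repr y.
Proof.
move=> xy; congr get; apply/funext => z; apply/propext => /=.
by rewrite (pdist0_eq _ xy).
Qed.

Lemma pdist_repr_idem x : pdist_repr (pdist_repr x) = pdist_repr x.
Proof. exact/esym/pdist_repr_eq/pdist_reprP. Qed.

(** Classes at distance 0, each represented by a chosen element. *)
Definition pdist_quot := {x : X | pdist_repr x = x}.

Definition pdist_class (x : X) : pdist_quot := exist _ _ (pdist_repr_idem x).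

Lemma pdist_classE x y : pdist_class x = pdist_class y <-> e x y = 0.
Proof.
split=> [[xy]|xy].
  by rewrite (pdist0_eq y (pdist_reprP x)) xy pdistC pdist_reprP.
by apply: eq_exist; exact: pdist_repr_eq.
Qed.

Lemma pdist_class_val (w : pdist_quot) : pdist_class (sval w) = w.
Proof. by case: w => x xE; apply: eq_exist. Qed.

Let qdist (v w : pdist_quot) : R := e (sval v) (sval w).

Let qdistxx v : qdist v v = 0. Proof. exact: pdistxx. Qed.

Let qdist_positivity v w : qdist v w = 0 -> v = w.
Proof.
by rewrite -{2}(pdist_class_val v) -{2}(pdist_class_val w) => /pdist_classE.
Qed.

Let qdistC v w : qdist v w = qdist w v. Proof. exact: pdistC. Qed.

Let qdist_triangle v u w : qdist u w <= qdist u v + qdist v w.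
Proof. exact: pdist_triangle. Qed.

HB.instance Definition _ := gen_eqMixin pdist_quot.
HB.instance Definition _ := gen_choiceMixin pdist_quot.
HB.instance Definition _ := isPointed.Build pdist_quot (pdist_class point).
HB.instance Definition _ := isMetric.Build R pdist_quot
  qdistxx qdist_positivity qdistC qdist_triangle.

Lemma mdist_class x y : mdist (pdist_class x) (pdist_class y) = e x y.
Proof.
transitivity (e (pdist_repr x) (pdist_repr y)); first by [].
rewrite -(pdist0_eq _ (pdist_reprP x)).
by rewrite pdistC -(pdist0_eq _ (pdist_reprP y)) pdistC.
Qed.

End metric_quotient.

Section besicovitch_pseudodistance.
Context (R : realType) (X : pmetricType R) (T : homeo X).
Hypothesis X_compact : compact [set: X].

Lemma mdist_bounded : exists2 D : R, 0 < D & forall x y : X, mdist x y <= D.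
Proof.
have [M M0 MP] := continuous_bounded X_compact
  (lipschitz_with_continuous (lipschitz_with_mdist (point : X))).
exists (2 * M) => [|x y]; first by rewrite mulr_gt0.
have := metric_triangle x point y; rewrite (metric_sym x point).
have := MP x; have := MP y; rewrite !ger0_norm ?mdist_ge0//; lra.
Qed.

Lemma mean_dist0_ge0 x y n : 0 <= mean_dist T x y 0 n.
Proof.
rewrite mean_dist0E mulr_ge0 ?invr_ge0// sumr_ge0// => i _; exact: mdist_ge0.
Qed.

Definition bdist (x y : X) : R := fine (besicovitch_dist T x y).

(** On a compact space all mean distances are bounded by the diameter. *)
Lemma bdistE x y : (bdist x y)%:E = besicovitch_dist T x y.
Proof.
rewrite /bdist fineK//; have [D D0 DP] := mdist_bounded.
rewrite ge0_fin_numE.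
  apply: (@le_lt_trans _ _ D%:E); last by rewrite ltry.
  apply: besicovitch_le; near=> n.
  rewrite mean_dist0E -[leRHS](@avg_cst R X T D n x); last first.
    by near: n; exact: nbhs_infty_gt.
  by rewrite ler_wpM2l ?invr_ge0//; apply: ler_sum => i _; exact: DP.
apply: limf_esup_ge0 => [|n].
  by case=> N _ /(_ N (leqnn N)).
by rewrite lee_fin mean_dist0_ge0.
Unshelve. all: by end_near. Qed.

Lemma bdist_near x y (c : R) : bdist x y < c ->
  \forall n \near \oo, mean_dist T x y 0 n < c.
Proof. by rewrite -lte_fin bdistE; exact: besicovitch_lt_near. Qed.

Let bdist_near_add x y (e : R) : 0 < e ->
  \forall n \near \oo, mean_dist T x y 0 n < bdist x y + e.
Proof. by move=> e0; apply: bdist_near; rewrite ltrDl. Qed.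

Lemma bdist_le x y (c : R) :
  (forall e : R, 0 < e -> \forall n \near \oo, mean_dist T x y 0 n <= c + e) ->
  bdist x y <= c.
Proof.
move=> H; apply/ler_addgt0Pr => e e0; rewrite -lee_fin bdistE.
by apply: besicovitch_le; exact: H.
Qed.

Let bdistxx x : bdist x x = 0.
Proof.
apply/eqP; rewrite eq_le; apply/andP; split.
  apply: bdist_le => e e0; apply: nearW => n.
  by rewrite mean_dist0E big1 ?mulr0 ?add0r ?ltW// => i _; rewrite mdistxx.
rewrite -lee_fin bdistE; apply: limf_esup_ge0 => [|n].
  by case=> N _ /(_ N (leqnn N)).
by rewrite lee_fin mean_dist0_ge0.
Qed.

Let bdistC x y : bdist x y = bdist y x.
Proof.
rewrite /bdist; congr (fine (limn_esup _)); apply/funext => n; congr EFin.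
by rewrite !mean_dist0E; under eq_bigr do rewrite metric_sym.
Qed.

Let bdist_triangle y x z : bdist x z <= bdist x y + bdist y z.
Proof.
apply: bdist_le => e e0; have e2 : 0 < e / 2 by exact: divr_gt0.
near=> n.
have xy : mean_dist T x y 0 n < bdist x y + e / 2.
  by near: n; exact: bdist_near_add.
have yz : mean_dist T y z 0 n < bdist y z + e / 2.
  by near: n; exact: bdist_near_add.
have : mean_dist T x z 0 n <= mean_dist T x y 0 n + mean_dist T y z 0 n.
  rewrite !mean_dist0E -mulrDr -big_split/= ler_wpM2l ?invr_ge0//.
  by apply: ler_sum => i _; exact: metric_triangle.
lra.
Unshelve. all: by end_near. Qed.

Definition besicovitch_pseudodist : pseudodist R X :=
  Pseudodist bdistxx bdistC bdist_triangle.

Let mean_dist_shift x y (e : R) : 0 < e -> \forall n \near \oo,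
  `|mean_dist T (T x) (T y) 0 n - mean_dist T x y 0 n| <= e.
Proof.
move=> e0; have [D D0 DP] := mdist_bounded.
pose TT (xy : X * X) := (T xy.1, T xy.2).
have TTE k : iter k TT (x, y) = (iter k T x, iter k T y).
  by elim: k => //= k ->.
have mE n : mean_dist T x y 0 n = avg TT (fun xy => mdist xy.1 xy.2) n (x, y).
  by rewrite mean_dist0E /avg; under [in RHS]eq_bigr do rewrite TTE.
have mTE n : mean_dist T (T x) (T y) 0 n =
    avg TT (fun xy => mdist xy.1 xy.2) n (TT (x, y)).
  rewrite mean_dist0E /avg; under [in RHS]eq_bigr do rewrite -iterSr/= TTE.
  by under [in LHS]eq_bigr do rewrite -!iterSr.
near=> n; rewrite mE mTE.
rewrite (le_trans (@avg_shift_bound _ _ _ _ D n _ _))//.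
  by move=> xy; rewrite ger0_norm ?mdist_ge0.
by near: n; exact: near_div_le.
Unshelve. all: by end_near. Qed.

Lemma bdist_T x y : bdist (T x) (T y) = bdist x y.
Proof.
apply/eqP; rewrite eq_le; apply/andP; split; apply: bdist_le => e e0;
  have e2 : 0 < e / 2 by exact: divr_gt0.
- near=> n.
  have : `|mean_dist T (T x) (T y) 0 n - mean_dist T x y 0 n| <= e / 2.
    by near: n; exact: mean_dist_shift.
  have : mean_dist T x y 0 n < bdist x y + e / 2.
    by near: n; exact: bdist_near_add.
  by rewrite ler_norml => ? /andP[? ?]; lra.
- near=> n.
  have : `|mean_dist T (T x) (T y) 0 n - mean_dist T x y 0 n| <= e / 2.
    by near: n; exact: mean_dist_shift.
  have : mean_dist T (T x) (T y) 0 n < bdist (T x) (T y) + e / 2.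
    by near: n; exact: bdist_near_add.
  by rewrite ler_norml => ? /andP[? ?]; lra.
Unshelve. all: by end_near. Qed.

Lemma bdist_inv x y : bdist (homeo_inv T x) (homeo_inv T y) = bdist x y.
Proof. by rewrite -bdist_T !homeo_invK. Qed.

End besicovitch_pseudodistance.

Section besicovitch_factor.
Context (R : realType) (X : pmetricType R) (T : homeo X).
Hypothesis X_compact : compact [set: X].
Hypothesis T_mean : mean_equicontinuous T.

Let e := besicovitch_pseudodist T X_compact.
Let W : pmetricType R := pdist_quot e.
Let q (x : X) : W := pdist_class e x.

Let mdist_q x y : mdist (q x) (q y) = bdist T x y.
Proof. exact: mdist_class. Qed.

Let mdist_W (v w : W) : mdist v w = bdist T (sval v) (sval w).
Proof. by []. Qed.

Let q_val (w : W) : q (sval w) = w.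
Proof. exact: pdist_class_val. Qed.

Let q_eq x y : bdist T x y = 0 -> q x = q y.
Proof. by move=> xy; apply/pdist_classE. Qed.

Let bdist_val x : bdist T (sval (q x)) x = 0.
Proof. by rewrite -mdist_q q_val mdistxx. Qed.

Let fW (f : X -> X) (w : W) : W := q (f (sval w)).

Let fW_cts (f : X -> X) : (forall x y, bdist T (f x) (f y) = bdist T x y) ->
  continuous (fW f).
Proof.
move=> fi; apply/continuous_mdistP => w c c0; exists c => // v.
by rewrite mdist_q fi.
Qed.

Let fW_K (f g : X -> X) : (forall x y, bdist T (f x) (f y) = bdist T x y) ->
  cancel g f -> cancel (fW g) (fW f).
Proof.
move=> fi gf w; rewrite -[RHS]q_val; apply: q_eq.
by rewrite -[X in bdist _ _ X](gf (sval w)) fi bdist_val.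
Qed.

Let U : homeo W := Homeo (fW_cts (bdist_T T X_compact))
  (fW_cts (bdist_inv T X_compact))
  (fW_K (bdist_inv T X_compact) (@homeo_funK _ T))
  (fW_K (bdist_T T X_compact) (@homeo_invK _ T)).

Let U_isometry j v w : mdist (ziter U j v) (ziter U j w) = mdist v w.
Proof.
case: j => n /=.
  elim: n => [//|n <-] /=; rewrite mdist_q bdist_T// -mdist_W//.
rewrite -!iterS; elim: n.+1 => [//|m <-] /=;
  rewrite mdist_q bdist_inv// -mdist_W//.
Qed.

(** Mean equicontinuity says that the projection to the quotient by the
    Besicovitch pseudodistance is continuous; the induced map is an isometry,
    because shifting time by one step does not affect limits of averages. *)
Lemma besicovitch_factor :
  exists (W : pmetricType R) (U : homeo W) (q : X -> W),
  [/\ compact [set: W], equicontinuous_system U, factor_map T U q &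
      forall x y, mdist (q x) (q y) = bdist T x y].
Proof.
have cq : continuous q.
  apply/continuous_mdistP => x c c0; have [d d0 dP] := T_mean c0.
  by exists d => // y xy; rewrite mdist_q -lte_fin bdistE// dP.
have rq : range q = [set: W].
  by apply/seteqP; split => // w _; exists (sval w).
exists W, U, q; split => //.
- by rewrite -rq; apply: continuous_compact => //;
  apply: continuous_subspaceT => x; exact: cq.
- move=> w E; rewrite -entourage_ballE => -[c /= c0 cE].
  apply/near_mdistP; exists c => // v wv j _; apply: cE => /=.
  by rewrite ballEmdist/= U_isometry.
- split => //; apply/funext => x /=; apply: q_eq.
  by rewrite bdist_T// -[LHS]mdist_q q_val mdistxx.
Qed.

End besicovitch_factor.

(** * Regularity of Borel probabilities *)

Section regularity.
Context (R : realType) (X : pmetricType R) (mu : probability (borel X) R).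
Local Open Scope ereal_scope.

Definition regular_set (A : set X) := forall e : R, (0 < e)%R ->
  exists F U, [/\ closed F, F `<=` A, open U, A `<=` U &
    mu (U `\` F : set (borel X)) <= e%:E].

Let open_diff (U F : set X) : open U -> closed F ->
  measurable (U `\` F : set (borel X)).
Proof. by move=> oU cF; apply: measurableD;
  [exact: open_borel|exact: closed_borel]. Qed.

Lemma regular_setC A : regular_set A -> regular_set (~` A).
Proof.
move=> Areg e e0; have [F [U [cF FA oU AU mUF]]] := Areg e e0.
exists (~` U), (~` F); split => //.
- exact: open_closedC.
- exact: subsetC.
- exact: closed_openC.
- exact: subsetC.
- by rewrite setDE setCK setIC -setDE.
Qed.

(** The closed sets of points at distance at least [1 / n] from the complement
    increase to the open set. *)
Lemma regular_open U : open U -> regular_set U.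
Proof.
move=> oU e e0.
pose F n := [set x | (n.+1%:R^-1 <= cdist (~` U) x)%R].
have cF n : closed (F n).
  apply: (@preimage_closed _ _ (cdist (~` U)) [set y | (n.+1%:R^-1 <= y)%R]).
    by move=> x _; exact: (lipschitz_with_continuous (@lipschitz_with_cdist _ _
      (~` U))).
  exact: closed_ge.
have FU n : F n `<=` U.
  move=> x; apply: contraPP => Ux; rewrite /F /= cdist0//.
  by apply/negP; rewrite -ltNge invr_gt0 ltr0n.
pose D n : set (borel X) := U `\` F n.
have : mu \o D @ \oo --> mu (\bigcap_n D n).
  apply: nonincreasing_cvg_mu => //.
  - by rewrite -ge0_fin_numE//; apply: fin_num_measure; exact: open_diff.
  - by move=> n; exact: open_diff.
  - by apply: bigcapT_measurable => n; exact: open_diff.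
  - move=> m n mn; apply/subsetPset => x [Ux Fx]; split => // Fmx; apply: Fx.
    rewrite /F /=; apply: le_trans Fmx; rewrite lef_pV2 ?posrE ?ltr0n//.
    by rewrite ler_nat ltnS.
have -> : \bigcap_n D n = set0.
  apply/seteqP; split => // x Dx.
  have [Ux _] := Dx 0%N I.
  have c0 : (0 < cdist (~` U) x)%R by apply: cdist_gt0;
    [exact: open_closedC|exact].
  have [n _ /(_ n (leqnn n)) /= nP] := nbhs_infty_ger (cdist (~` U) x)^-1.
  have [_] := Dx n I; apply.
  rewrite /F /= -[leRHS]invrK lef_pV2 ?posrE ?invr_gt0 ?ltr0n//.
  by rewrite (le_trans nP)// ler_nat.
rewrite measure0 => /fine_cvgP[_ /cvgr0Pnorm_le/(_ _ e0)[n _ /(_ n (leqnn n))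
  /= nP]].
exists (F n), U; split => //.
rewrite -[mu _]fineK; last by apply: fin_num_measure; exact: open_diff.
by rewrite lee_fin (le_trans (ler_norm _)).
Qed.

(** The union of the outer open sets is open; the union of all inner closed sets
    is not closed, but finitely many of them suffice up to small measure. *)
Lemma regular_bigcup (A : nat -> set X) : (forall n, regular_set (A n)) ->
  regular_set (\bigcup_n A n).
Proof.
move=> Areg e e0; have e2 : (0 < e / 2)%R by exact: divr_gt0.
have /choice[FU FUP] n : exists FU : set X * set X,
    [/\ closed FU.1, FU.1 `<=` A n, open FU.2, A n `<=` FU.2 &
      mu (FU.2 `\` FU.1 : set (borel X)) <= (e / 2 / (2 ^ n.+1)%:R)%:E].
  have [|F [U FUP]] := Areg n (e / 2 / (2 ^ n.+1)%:R)%R.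
    by rewrite divr_gt0// ltr0n expn_gt0.
  by exists (F, U).
pose F n := (FU n).1; pose U := \bigcup_n (FU n).2.
pose D n : set (borel X) := U `\` \big[setU/set0]_(i < n) F i.
have oU : open U by apply: bigcup_open => n _; case: (FUP n).
have cF n : closed (\big[setU/set0]_(i < n) F i).
  by apply: closed_bigsetU => i _; case: (FUP i).
have mD n : measurable (D n) by exact: open_diff.
have mbigD : measurable (\bigcap_n D n) by exact: bigcapT_measurable.
have cD : mu \o D @ \oo --> mu (\bigcap_n D n).
  apply: nonincreasing_cvg_mu => //.
    by rewrite -ge0_fin_numE//; exact: fin_num_measure.
  move=> m n mn; apply/subsetPset; apply: setDS => x.
  by rewrite -!bigcup_mkord => -[i /= im Fx]; exists i => //;
    exact: leq_trans mn.
have bigD : mu (\bigcap_n D n) <= (e / 2)%:E.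
  apply: le_trans (epsilon_trick0 xpredT (ltW e2)).
  pose G n : set (borel X) := (FU n).2 `\` (FU n).1.
  apply: (@le_trans _ _ (\sum_(n <oo) mu (G n))); last first.
    by apply: lee_nneseries => // n *; case: (FUP n).
  apply: measure_sigma_subadditive => //.
    by move=> n; case: (FUP n) => ? ? ? ? _; exact: open_diff.
  move=> x Dx; have [[n _ Ux] _] := Dx 0%N I; exists n => //; split => // Fx.
  have [_] := Dx n.+1 I; apply; rewrite -bigcup_mkord; exists n => //=.
have [n Dn] : exists n, mu (D n) <= e%:E.
  move: cD bigD; rewrite -[mu (\bigcap_n D n)]fineK;
    last exact: fin_num_measure.
  set l := fine (mu (\bigcap_n D n)).
  move=> /fine_cvgP[_ /cvgrPdist_lt/(_ _ e2)[n _ /(_ n (leqnn n))]].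
  rewrite lee_fin/= ltr_norml => /andP[H _] le2; exists n.
  rewrite -[mu _]fineK; last exact: fin_num_measure.
  rewrite lee_fin; move: H le2; rewrite /=; lra.
exists (\big[setU/set0]_(i < n) F i), U; split => //.
- rewrite -bigcup_mkord => x [i _ Fx]; exists i => //.
  by case: (FUP i) => _ FA _ _ _; exact: FA.
- move=> x [i _ Ax]; exists i => //.
  by case: (FUP i) => _ _ _ AU _; exact: AU.
Qed.

Lemma borel_regular (A : set (borel X)) : measurable A -> regular_set A.
Proof.
apply: smallest_sub; last by move=> U; exact: regular_open.
split.
- by apply: regular_open; exact: open0.
- by move=> B Breg; rewrite setTD; exact: regular_setC.
- exact: regular_bigcup.
Qed.

(** F_sigma sets are what a continuous map on a compact space sends to Borel
    sets, so this form of regularity allows sets to be pushed forward. *)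
Lemma inner_Fsigma (A : set (borel X)) : measurable A ->
  exists F : nat -> set X, [/\ forall n, closed (F n), forall n, F n `<=` A &
    mu (A `\` \bigcup_n F n) = 0].
Proof.
move=> mA; have e0 n : (0 < n.+1%:R^-1 :> R)%R by rewrite invr_gt0 ltr0n.
have /choice[F FP] n : exists F : set X, [/\ closed F, F `<=` A &
    mu (A `\` F) <= (n.+1%:R^-1)%:E].
  have [F [U [cF FA oU AU mUF]]] := borel_regular mA (e0 n).
  exists F; split => //; apply: le_trans mUF.
  apply: le_measure; rewrite ?inE; [|exact: open_diff|exact: setSD].
  by apply: measurableD => //; exact: closed_borel.
have mF n : measurable (F n : set (borel X)).
  by apply: closed_borel; case: (FP n).
exists F; split; [by move=> n; case: (FP n)|by move=> n; case: (FP n)|].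
apply/eqP; rewrite eq_le measure_ge0 andbT.
apply/lee_addgt0Pr => e ep; rewrite add0e.
have [n _ /(_ n (leqnn n)) /= nP] := nbhs_infty_ger e^-1.
case: (FP n) => _ _ mAF; apply: (@le_trans _ _ (mu (A `\` F n))).
  apply: le_measure; rewrite ?inE.
  - by apply: measurableD => //; exact: bigcupT_measurable.
  - exact: measurableD.
  - by apply: setDS => x Fx; exists n.
apply: le_trans mAF _; rewrite lee_fin -[leRHS]invrK.
by rewrite lef_pV2 ?posrE ?invr_gt0 ?ltr0n// (le_trans nP)// ler_nat.
Qed.

End regularity.

(** * Continuous maps injective off a null set *)

Section injective_off_null.
Context (R : realType) (X Z : pmetricType R).
Variables (mu : probability (borel X) R) (nu : probability (borel Z) R).
Variable p : X -> Z.
Hypothesis X_compact : compact [set: X].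
Hypothesis p_cts : continuous p.
Hypothesis p_image : forall B : set (borel Z), measurable B ->
  mu (p @^-1` B) = nu B.

Let mp := borel_preimage p_cts.

Let image_Fsigma (F : nat -> set X) : (forall n, closed (F n)) ->
  measurable (p @` (\bigcup_n F n) : set (borel Z)).
Proof.
move=> cF; rewrite image_bigcup; apply: bigcupT_measurable => n.
apply: closed_borel; apply: compact_closed; first exact: metric_hausdorff.
apply: continuous_compact; first exact: continuous_subspaceT.
by apply: (subclosed_compact _ X_compact).
Qed.

Let preimage_negligible (M : set (borel Z)) : nu.-negligible M ->
  mu.-negligible (p @^-1` M : set (borel X)).
Proof.
move=> [M' [mM' M'0 MM']]; exists (p @^-1` M'); split; first exact: mp.
- by rewrite p_image.
- by move=> x /MM'.
Qed.

(** The set [X0] can be taken to be an F_sigma set of full measure on which [p]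
    is injective. Then [p] sends the F_sigma subsets of [X0] to Borel sets, and
    every measurable set differs from such a subset by a null set. *)
Lemma injective_off_null_isomorphism (N : set (borel X)) : mu.-negligible N ->
  (forall x y, ~ N x -> ~ N y -> p x = p y -> x = y) ->
  measure_isomorphism mu nu p.
Proof.
move=> [N' [mN' N'0 NN']] p_inj; split => //.
have [F [cF FN muF]] := inner_Fsigma mu (measurableC mN').
set X0 : set (borel X) := \bigcup_n F n in muF.
have mX0 : measurable X0 by apply: bigcupT_measurable => n; exact: closed_borel.
have X0N x : X0 x -> ~ N' x by move=> [n _ /FN].
have X0_inj x y : X0 x -> X0 y -> p x = p y -> x = y.
  by move=> /X0N xN /X0N yN; apply: p_inj => /NN'.
have nullD (A : set (borel X)) (G : nat -> set X) : measurable A ->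
    (forall n, closed (G n)) -> mu (A `\` \bigcup_n G n) = 0%E ->
    mu.-negligible (A `\` \bigcup_n G n).
  move=> mA cG AG0; exists (A `\` \bigcup_n G n); split => //.
  apply: measurableD => //; apply: bigcupT_measurable => n.
  exact: closed_borel.
have nX0 : mu.-negligible (~` X0).
  have nN' : mu.-negligible N' by exists N'; split.
  apply: negligibleS (negligibleU nN' (nullD _ _ (measurableC mN') cF muF)).
  by move=> x X0x; have [|] := pselect (N' x); [left|right].
pose Z0 : set (borel Z) := p @` X0.
(* A set [M] of measure 0 leaves, inside its complement in [X0], an F_sigma set
   of full measure; its image is Borel, of full measure, and by injectivity
   misses the image of [M]. *)
have image_negligible (M : set (borel X)) : M `<=` X0 -> mu.-negligible M ->
    nu.-negligible (p @` M : set (borel Z)).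
  move=> MX0 [M' [mM' M'0 MM']].
  have [G [cG GM muG]] := inner_Fsigma mu (measurableD mX0 mM').
  have mG : measurable (p @` (\bigcup_n G n) : set (borel Z)) by exact:
    image_Fsigma.
  exists (~` (p @` (\bigcup_n G n))); split; first exact: measurableC.
    rewrite -p_image; last exact: measurableC.
    apply: measure_negligible; first by apply: mp; exact: measurableC.
    have nM' : mu.-negligible M' by exists M'; split.
    apply: negligibleS (negligibleU (negligibleU nX0 nM')
      (nullD _ _ (measurableD mX0 mM') cG muG)).
    move=> x /= pGx; have [X0x|] := pselect (X0 x); last by left; left.
    have [|M'x] := pselect (M' x); [by left; right|right; split => // Gx].
    by apply: pGx; exists x.
  move=> _ [x Mx <-] [y [n _ Gy] pyx].
  have [X0y M'y] := GM n y Gy.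
  by apply: M'y; rewrite (X0_inj y x)//; [exact: MM'|exact: MX0].
have mZ0 : measurable Z0 by exact: image_Fsigma.
exists X0, Z0; split.
- exact: nX0.
- exists (~` Z0); split => //; first exact: measurableC.
  rewrite -p_image; last exact: measurableC.
  apply: measure_negligible; first by apply: mp; exact: measurableC.
  by apply: negligibleS nX0 => x; apply: contra_not => X0x; exists x.
- split; [by move=> x X0x; exists x| |by []].
  by move=> x y; rewrite !inE => X0x X0y; exact: X0_inj.
- move=> B _ [A mA [M nM <-]].
  rewrite preimage_setU setIUr; exists (X0 `&` p @^-1` A).
    by apply: measurableI => //; exact: mp.
  exists (X0 `&` p @^-1` M) => //.
  by apply: negligibleS (preimage_negligible nM) => x [].
- move=> A' AX0 [A mA [M nM AME]]; rewrite -AME in AX0 *.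
  have [G [cG GA muG]] := inner_Fsigma mu mA.
  exists (p @` (\bigcup_n G n)); first exact: image_Fsigma.
  exists (p @` (A `\` \bigcup_n G n `|` M)).
    apply: image_negligible.
      by move=> x [[Ax _]|Mx]; apply: AX0; [left|right].
    by apply: negligibleU => //; exact: nullD.
  rewrite -image_setU; congr (p @` _); rewrite setUA; congr (_ `|` _).
  apply/seteqP; split=> [x [[n _ /GA]|[]]//|x Ax].
  by have [|] := pselect ((\bigcup_n G n) x); [left|right].
Qed.

End injective_off_null.

(** * Mean equicontinuity implies an isomorphic extension *)

Lemma measurable_fun_glue d (T : measurableType d) (R : realType)
    (idx : T -> nat) (G : nat -> T -> R) :
  (forall n, measurable (idx @^-1` [set n])) ->
  (forall n, measurable_fun [set: T] (G n)) ->
  measurable_fun [set: T] (fun x => G (idx x) x).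
Proof.
move=> midx mG _ Y mY; rewrite setTI.
rewrite (_ : _ @^-1` _ = \bigcup_n (idx @^-1` [set n] `&` G n @^-1` Y)).
  apply: bigcupT_measurable => n; apply: measurableI => //.
  by rewrite -[X in measurable X]setTI; exact: mG.
apply/seteqP; split=> [x Yx|x [n _ [/= <-]]//].
by exists (idx x).
Qed.

Section compact_net.
Context (R : realType) (X : pmetricType R).

Lemma compact_net (d : R) : compact [set: X] -> 0 < d ->
  exists (J : nat) (y : nat -> X),
    forall x, exists2 j, (j < J)%N & mdist (y j) x < d.
Proof.
move=> cX d0; move: (cX); rewrite compact_cover.
move=> /(_ X setT (fun x => interior (ball x d)))[|x _|D _ Dcov].
- by move=> x _; exact: open_interior.
- by exists x => //; exact: nbhsx_ballx.
pose s := finmap.enum_fset D.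
exists (size s), (nth point s) => x; have [y yD yx] := Dcov x I.
exists (index y s); first by rewrite index_mem.
by rewrite nth_index//; move/interior_subset : yx; rewrite ballEmdist.
Qed.

End compact_net.

Section factor_sections.
Context (R : realType) (X Z W : pmetricType R) (T : homeo X) (S : homeo Z).
Variables (p : X -> Z) (r : Z -> W) (mu : probability (borel X) R).
Hypothesis X_compact : compact [set: X].
Hypothesis T_mean : mean_equicontinuous T.
Hypothesis p_factor : factor_map T S p.
Hypothesis r_cts : continuous r.
Hypothesis r_dist : forall x y, mdist (r (p x)) (r (p y)) = bdist T x y.
Hypothesis mu_inv : invariant_measure T mu.

Let p_cts : continuous p. Proof. by case: p_factor. Qed.

Let mp := borel_preimage p_cts.

(** The points of [Z] whose image under [r] is close to that of a given net
    point form an open set; these sets cover [Z], as the net is fine enough, and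
    the least index of one containing [z] is a Borel function of [z]. *)
Lemma besicovitch_section (e : R) : 0 < e ->
  exists (idx : Z -> nat) (y : nat -> X),
    (forall n, measurable (idx @^-1` [set n] : set (borel Z))) /\
    forall x, bdist T x (y (idx (p x))) < e.
Proof.
move=> e0; have [d d0 dP] := T_mean e0.
have [J [y yP]] := compact_net X_compact d0.
pose O j : set Z := r @^-1` [set w | mdist (r (p (y j))) w < e].
have oO j : open (O j).
  move/continuousP : (r_cts); apply.
  have := @open_comp _ _ (mdist (r (p (y j)))) [set t | t < e].
  apply => [w _|]; last exact: open_lt.
  exact: (lipschitz_with_continuous (@lipschitz_with_mdist _ _ (r (p (y j))))).
have Ocov z : exists j, `[< O j z >].
  have [x _ <-] : range p z by case: p_factor => _ -> _.
  have [j _ yx] := yP x; exists j; apply/asboolP.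
  by rewrite /O /= r_dist -lte_fin bdistE//; exact: dP.
exists (fun z => ex_minn (Ocov z)), y; split=> [n|x]; last first.
  case: ex_minnP => j /asboolP jO _.
  by rewrite -r_dist metric_sym; exact: jO.
rewrite (_ : _ @^-1` _ = O n `\` \bigcup_(i in `I_n) O i).
  apply: measurableD; first exact: open_borel.
  by apply: bigcup_measurable => i _; exact: open_borel.
apply/seteqP; split=> [z /=|z /= [/asboolP nz H]].
  case: ex_minnP => j /asboolP Oz jmin <-; split => // -[i /= ij /asboolP].
  by move/jmin; rewrite leqNgt ij.
case: ex_minnP => j /asboolP Oz jmin; apply/eqP.
rewrite eqn_leq jmin//= leqNgt; apply/negP => jn.
by apply: H; exists j.
Qed.

(** By invariance of [mu] the average over [i] of the integrals of
    [d (T^i x, T^i y)] is an integral of Besicovitch averages, and [y (idx z)]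
    may be moved along the orbit without leaving the class of step functions. *)
Lemma factor_section (e : R) : 0 < e ->
  exists2 s : Z -> X,
    @bounded_measurable _ (borel X) R (fun x => mdist x (s (p x))) &
    \int[mu]_x mdist x (s (p x)) <= e.
Proof.
move=> e0; have e2 : 0 < e / 2 by exact: divr_gt0.
have [idx [y [midx yP]]] := besicovitch_section e2.
have [D D0 DP] := mdist_bounded X_compact.
have bglue (jdx : Z -> nat) (G : nat -> X -> R) :
    (forall n, measurable (jdx @^-1` [set n] : set (borel Z))) ->
    (forall n, continuous (G n)) -> (forall n x, `|G n x| <= D) ->
    @bounded_measurable _ (borel X) R (fun x => G (jdx (p x)) x).
  move=> mjdx cG GD; split; last by exists D.
  apply: (@measurable_fun_glue _ (borel X) R (jdx \o p) G).
    by move=> n; rewrite comp_preimage; exact: mp.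
  by move=> n; exact: continuous_measurable_real.
have cdx (f : X -> X) a : continuous f -> continuous (fun x => mdist (f x) a).
  move=> cf x; apply: (@continuous_comp _ _ _ f (fun t => mdist t a)).
    exact: cf.
  have -> : (fun t => mdist t a) = mdist a.
    by apply/funext => t; rewrite metric_sym.
  exact: (lipschitz_with_continuous (@lipschitz_with_mdist _ _ a)).
pose F i x := mdist (iter i T x) (iter i T (y (idx (p x)))).
have bF i : @bounded_measurable _ (borel X) R (F i).
  apply: (@bglue idx (fun n x => mdist (iter i T x) (iter i T (y n)))) => //.
    by move=> n; apply: cdx; apply: continuous_iter; exact: homeo_cts.
  by move=> n x; rewrite ger0_norm ?mdist_ge0.
pose A n x := mean_dist T x (y (idx (p x))) 0 n.
have AE n : A n = fun x => n%:R^-1 * \sum_(i < n) F i x.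
  by apply/funext => x; rewrite /A mean_dist0E.
have bA n : @bounded_measurable _ (borel X) R (A n).
  by rewrite AE; apply: bounded_measurableM; exact: bounded_measurable_sum.
pose B n x := Num.max (A n x) (e / 2).
have bB n : @bounded_measurable _ (borel X) R (B n).
  by apply: bounded_measurable_max => //; exact: bounded_measurable_cst.
have cB : (fun n => \int[mu]_x B n x) @ \oo --> \int[mu]_x (e / 2).
  apply: (@cvg_Rint _ _ _ mu B _ (Num.max D (e / 2))) => [n|n x|x].
  - by case: (bB n).
  - have A0 : 0 <= A n x by exact: mean_dist0_ge0.
    have AD : A n x <= D.
      rewrite /A mean_dist0E; case: n {A0} => [|n].
        by rewrite invr0 mul0r ltW.
      rewrite -[leRHS](@avg_cst R X T D n.+1 x)// ler_wpM2l ?invr_ge0//.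
      by apply: ler_sum => i _; exact: DP.
    rewrite ger0_norm; last by rewrite le_max A0.
    by rewrite ge_max !le_max AD lexx orbT.
  - apply: cvg_near_cst; apply: filterS (bdist_near X_compact (yP x)) => n An.
    by apply/max_idPr/ltW.
rewrite Rint_cst in cB.
have [n n0 Bn] : exists2 n, (0 < n)%N & \int[mu]_x B n x < e.
  have e2e : e / 2 < e by lra.
  have [N _ NP] := cvgr_lt _ cB _ e2e.
  by exists N.+1 => //; apply: NP => /=.
have An : \int[mu]_x A n x < e.
  by apply: le_lt_trans Bn; apply: le_Rint => // x; rewrite le_max lexx.
have [i iF] : exists i, \int[mu]_x F i x <= e.
  apply: contrapT => /forallNP H; move: An; rewrite AE RintM; last first.
    exact: bounded_measurable_sum.
  rewrite Rint_sum// ltNge => /negP; apply.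
  rewrite -[leLHS](@avg_cst R X T e n point n0) ler_wpM2l ?invr_ge0//.
  by apply: ler_sum => i _; have /negP := H i; rewrite -ltNge => /ltW.
have pinv x : iter i (homeo_inv S) (p (iter i T x)) = p x.
  rewrite (factor_iter p_factor); elim: (i) => [//|k ih].
  by rewrite iterSr iterS homeo_funK.
pose H x := mdist x (iter i T (y (idx (iter i (homeo_inv S) (p x))))).
have bH : @bounded_measurable _ (borel X) R H.
  apply: (@bglue (idx \o iter i (homeo_inv S)) (fun n x => mdist x (iter i T (y
    n)))).
  - move=> m; rewrite comp_preimage.
    by apply: borel_preimage => //; apply: continuous_iter;
      exact: homeo_inv_cts.
  - by move=> m; apply: (@cdx id) => x; exact: cvg_id.
  - by move=> m x; rewrite ger0_norm ?mdist_ge0.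
exists (fun z => iter i T (y (idx (iter i (homeo_inv S) z)))) => //.
apply: le_trans iF; rewrite -(invariant_Rint_iter i mu_inv bH).
rewrite le_eqVlt; apply/orP; left; apply/eqP; apply: eq_Rintegral => x _.
by rewrite /H pinv.
Qed.


(** By the Borel-Cantelli lemma, sections with summable errors converge almost
    everywhere: [s k (p x)] tends to [x], so that [p x] determines [x]. *)
Lemma factor_injective_off_null : exists2 N : set (borel X), mu.-negligible N &
  forall x y, ~ N x -> ~ N y -> p x = p y -> x = y.
Proof.
(* The factor [1 / (k + 1)] pays for the threshold in Markov's inequality. *)
have e0 k : 0 < k.+1%:R^-1 / (2 ^ k.+1)%:R :> R.
  by rewrite divr_gt0 ?invr_gt0 ?ltr0n ?expn_gt0.
have /choice[s sP] k : exists s : Z -> X,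
    @bounded_measurable _ (borel X) R (fun x => mdist x (s (p x))) /\
    \int[mu]_x mdist x (s (p x)) <= k.+1%:R^-1 / (2 ^ k.+1)%:R.
  by have [s ? ?] := factor_section (e0 k); exists s.
pose F k : set (borel X) := [set x | k.+1%:R^-1 < mdist x (s k (p x))].
have mF k : measurable (F k).
  have [[ms _] _] := sP k.
  have -> : F k = (fun x => mdist x (s k (p x))) @^-1` `]k.+1%:R^-1,
    +oo[%classic.
    by apply/seteqP; split=> x; rewrite /F /= in_itv/= andbT.
  by rewrite -[X in measurable X]setTI; apply: ms => //; exact: measurable_itv.
have muF k : (mu (F k) <= (1 / (2 ^ k.+1)%:R)%:E)%E.
  have [bs sI] := sP k; have k0 : 0 < k.+1%:R :> R by rewrite ltr0n.
  rewrite -[mu (F k)]fineK ?fin_num_measure// lee_fin -Rint_indic//.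
  rewrite div1r -(ler_pM2l (_ : 0 < k.+1%:R^-1)) ?invr_gt0//.
  apply: le_trans sI; rewrite -RintM; last exact: bounded_measurable_indic.
  apply: le_Rint => // [|x].
    by apply: bounded_measurableM; exact: bounded_measurable_indic.
  rewrite indicE; case: (boolP (x \in F k)) => [|_].
    by rewrite inE mulr1 => /ltW.
  by rewrite mulr0 mdist_ge0.
exists (lim_sup_set F).
  exists (lim_sup_set F); split => //.
    by apply: bigcapT_measurable => n; apply: bigcup_measurable => j _.
  apply: lim_sup_set_cvg0 => //; apply: (@le_lt_trans _ _ 1%:E);
    last exact: ltry.
  apply: le_trans (epsilon_trick0 xpredT (@ler01 R)).
  by apply: lee_nneseries => // k *; exact: muF.
have near_in x : ~ lim_sup_set F x -> exists n, forall k, (n <= k)%N ->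
    mdist x (s k (p x)) <= k.+1%:R^-1.
  move=> Fx; apply: contrapT => /forallNP H; apply: Fx => n _.
  have /existsNP[k /not_implyP[nk /negP]] := H n.
  by rewrite -ltNge => Fkx; exists k.
move=> x y /near_in[n xn] /near_in[m ym] pxy.
apply: mdist_positivity; apply/eqP; rewrite eq_le mdist_ge0 andbT.
apply/ler_addgt0Pr => c c0; rewrite add0r.
have [j _ /(_ j (leqnn j)) /= jP] := nbhs_infty_ger (2 / c).
pose k := (maxn j (maxn n m)).
have k1 : k.+1%:R^-1 <= c / 2.
  rewrite -[leRHS]invrK invf_div lef_pV2 ?posrE ?divr_gt0 ?ltr0n//.
  by rewrite (le_trans jP)// ler_nat ltnW// ltnS leq_maxl.
have xk : mdist x (s k (p y)) <= k.+1%:R^-1.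
  by rewrite -pxy; apply: xn; rewrite /k !leq_max leqnn !orbT.
have yk : mdist (s k (p y)) y <= k.+1%:R^-1.
  by rewrite metric_sym; apply: ym; rewrite /k !leq_max leqnn !orbT.
have := metric_triangle x (s k (p y)) y; move: xk yk k1.
by move: (k.+1%:R^-1) => b; lra.
Qed.

End factor_sections.

(** The maximal equicontinuous factor separates points at positive Besicovitch
    distance, as the quotient by that distance is an equicontinuous factor. *)
Lemma mean_equicontinuous_isomorphic_extension (R : realType)
    (X Z : pmetricType R) (T : homeo X) (S : homeo Z) :
  compact [set: X] -> minimal T -> maximal_equicontinuous_factor T S ->
  mean_equicontinuous T -> isomorphic_extension T S.
Proof.
move=> cX Tmin [cZ Seq [p pf pmax]] Tmean.
have [W [U [q [cW Ueq qf qd]]]] := besicovitch_factor cX Tmean.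
have [r [cr _ _] qE] := pmax W U q cW Ueq qf.
have rd x y : mdist (r (p x)) (r (p y)) = bdist T x y.
  by rewrite -qd qE.
have [mu muT] := mean_equicontinuous_uniquely_ergodic cX Tmin Tmean.
have [nu nuS] := mean_equicontinuous_uniquely_ergodic cZ (factor_minimal pf
  Tmin)
  (equicontinuous_mean_equicontinuous cZ Seq).
exists mu, nu; split => //; exists p => //.
have mp : measurable_fun [set: borel X] (p : borel X -> borel Z).
  by apply: continuous_borel; case: pf.
have [N nN Ninj] := factor_injective_off_null cX Tmean pf cr rd muT.1.
apply: (injective_off_null_isomorphism cX _ _ nN Ninj); first by case: pf.
move=> B mB; have [nu' nu'E] := @pushforward_probability _ _ (borel X) (borel
  Z) _ mu p mp.
rewrite nu'E//; apply: nuS.2 => // A mA.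
have mSA : measurable (S @^-1` A : set (borel Z)).
  by apply: borel_preimage => //; exact: homeo_cts.
rewrite -!nu'E// -comp_preimage; case: (pf) => _ _ <-.
rewrite comp_preimage; apply: muT.1; apply: borel_preimage => //.
by case: pf.
Qed.

(** * Isomorphic extensions are Weyl mean equicontinuous *)

Section uniform_averages.
Context (R : realType) (X : pmetricType R) (T : homeo X).
Hypothesis X_compact : compact [set: X].

(** Otherwise long averages staying above [c] would have a limit measure that
    is invariant but different from [mu]. *)
Lemma uniform_avg (mu : probability (borel X) R) (F : X -> R) (c : R) :
  unique_invariant_measure T mu -> continuous F -> \int[mu]_x F x < c ->
  exists N : nat, forall n x, (N <= n)%N -> avg T F n x < c.
Proof.
move=> [muT mu_unique] cF Fc; apply: contrapT => /forallNP H.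
have /choice[nx nxP] k : exists nx : nat * X,
    (k < nx.1)%N /\ c <= avg T F nx.1 nx.2.
  have /existsNP[n /existsNP[x /not_implyP[kn /negP]]] := H k.+1.
  by rewrite -leNgt => cF'; exists (n, x).
have [mu' mu'T mu'F] := @empirical_limit _ _ T X_compact (fun k => (nx k).2)
  (fun k => (nx k).1) (fun k => (nxP k).1).
have := mu'F F c cF (fun k => (nxP k).2).
rewrite /Rintegral (eq_measure_integral mu) -/(Rintegral mu setT F).
  by rewrite leNgt Fc.
by move=> A mA _; exact: mu_unique.
Qed.

End uniform_averages.

Section continuous_lifts.
Context (R : realType) (X Z : pmetricType R).
Variables (mu : probability (borel X) R) (nu : probability (borel Z) R).
Variable p : X -> Z.
Hypothesis p_cts : continuous p.
Hypothesis Z_compact : compact [set: Z].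
Hypothesis p_iso : measure_isomorphism mu nu p.

Let mp := borel_preimage p_cts.

(** The image of [A] under [p] is Borel up to a null set, and the preimage of
    that image is again [A] up to a null set, because [p] is injective on a set
    of full measure. *)
Lemma isomorphism_preimage (A : set (borel X)) : measurable A ->
  exists2 B : set (borel Z), measurable B &
    exists2 N : set (borel X), mu.-negligible N &
      forall x, ~ N x -> A x <-> B (p x).
Proof.
move=> mA; have [mup [X0 [Z0 [[M [mM M0 X0M]] _ [X0Z0 p_inj _] _ p_image]]]] :=
  p_iso.
have AX0 : A `\` M `<=` X0.
  by move=> x [_ Mx]; apply: contrapT => /X0M.
have [|B mB [N [N' [mN' N'0 NN']] AE]] := p_image _ AX0.
  exists (A `\` M); first exact: measurableD.
  by exists set0; [exact: negligible_set0|rewrite setU0].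
exists B => //; exists (M `|` p @^-1` N').
  apply: negligibleU; first by exists M; split.
  by exists (p @^-1` N'); split => //;
    [exact: mp|exact: etrans (mup _ mN') N'0].
move=> x /not_orP[Mx Nx]; split=> [Ax|Bx].
  have : (p @` (A `\` M)) (p x) by exists x.
  by rewrite -AE => -[//|/NN'].
have : (p @` (A `\` M)) (p x) by rewrite -AE; left.
move=> [x' [Ax' Mx'] pxx'].
rewrite (p_inj x x')// inE; first by apply: contrapT => /X0M.
by apply: AX0.
Qed.

(** In measure, [A] is the preimage of a Borel set [B]; by regularity [B] is
    approximated by an open set, whose indicator is a limit of bumps. *)
Lemma indic_continuous_lift (A : set (borel X)) (e : R) :
  measurable A -> 0 < e ->
  exists2 h : Z -> R, continuous h &
    \int[mu]_x `|\1_A x - h (p x)| <= e.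
Proof.
move=> mA e0; have e2 : 0 < e / 2 by exact: divr_gt0.
have [B mB [N nN AB]] := isomorphism_preimage mA.
have [F [U [cF FB oU BU nuUF]]] := borel_regular nu mB e2.
have mU : measurable (U : set (borel Z)) by exact: open_borel.
have bi (C : set (borel Z)) : measurable C ->
    @bounded_measurable _ (borel X) R (fun x => \1_C (p x)).
  by move=> mC; apply: (@bounded_measurable_indic _ (borel X) R (p @^-1` C));
    exact: mp.
have bbump k : @bounded_measurable _ (borel X) R (fun x => bump U k (p x)).
  split; last first.
    by exists 1 => x; rewrite ger0_norm ?bump_ge0 ?bump_le1.
  apply: continuous_measurable_real => x; apply: continuous_comp;
    first exact: p_cts.
  exact: (lipschitz_with_continuous (@lipschitz_with_bump _ _ U k)).
have cvg0 : (fun k => \int[mu]_x `|\1_U (p x) - bump U k (p x)|) @ \oo -->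
    \int[mu]_x (0 : R).
  apply: (@cvg_Rint _ _ _ mu _ _ 1) => [k|k x|x].
  - by case: (bounded_measurable_norm (bounded_measurableB (bi _ mU) (bbump
    k))).
  - rewrite normr_id indicE; have := bump_ge0 U k (p x);
    have := bump_le1 U k (p x).
    by case: (p x \in U) => b1 b0; rewrite ler_norml /=; lra.
  - rewrite -(normr0 R) -(subrr (\1_U (p x) : R)); apply: cvg_norm.
    by apply: cvgB; [exact: cvg_cst|exact: bump_cvg].
rewrite Rint_cst in cvg0.
have [k kP] : exists k, \int[mu]_x `|\1_U (p x) - bump U k (p x)| < e / 2.
  have [k _ kP] := cvgr_lt _ cvg0 _ e2.
  by exists k; exact: (kP k (leqnn k)).
exists (bump U k).
  exact: (lipschitz_with_continuous (@lipschitz_with_bump _ _ U k)).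
have bA : @bounded_measurable _ (borel X) R (\1_A : X -> R).
  exact: bounded_measurable_indic.
have mUB : measurable (U `\` B : set (borel Z)) by exact: measurableD.
have bN : @bounded_measurable _ (borel X) R (fun x => `|\1_A x - \1_B (p x)|).
  by apply/bounded_measurable_norm/bounded_measurableB => //; exact: bi.
have bUk : @bounded_measurable _ (borel X) R
    (fun x => `|\1_U (p x) - bump U k (p x)|).
  by apply/bounded_measurable_norm/bounded_measurableB => //; exact: bi.
have bkU : @bounded_measurable _ (borel X) R
    (fun x => \1_(U `\` B) (p x) + `|\1_U (p x) - bump U k (p x)|).
  by apply: bounded_measurableD => //; exact: bi.
apply: (@le_trans _ _ (\int[mu]_x (`|\1_A x - \1_B (p x)| +
    (\1_(U `\` B) (p x) + `|\1_U (p x) - bump U k (p x)|)))).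
  apply: le_Rint => [||x].
  - by apply/bounded_measurable_norm/bounded_measurableB.
  - exact: bounded_measurableD.
  - rewrite -(subrKA (\1_B (p x))) (le_trans (ler_normD _ _))// lerD2l.
    rewrite -(subrKA (\1_U (p x))) (le_trans (ler_normD _ _))// lerD2r.
    rewrite !indicE; have [Bx|Bx] := boolP (p x \in B).
      rewrite (_ : p x \in U) ?subrr ?normr0//.
      by rewrite inE; apply: BU; rewrite inE in Bx.
    have [Ux|Ux] := boolP (p x \in U).
      rewrite mem_set ?sub0r ?normrN ?normr1//.
      by split; [rewrite inE in Ux|rewrite notin_setE in Bx].
    by rewrite subrr normr0.
rewrite RintD//.
rewrite [X in X + _](@Rint_ae0 _ _ _ mu _ N)//; last first.
  move=> x Nx; rewrite !indicE.
  have -> : (x \in A) = (p x \in B).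
    by apply/idP/idP; rewrite !inE; apply AB.
  by rewrite subrr normr0.
rewrite add0r RintD//; last exact: bi.
rewrite (splitr e) lerD ?(ltW kP)//.
have -> : (fun x => \1_(U `\` B) (p x) : R) = \1_(p @^-1` (U `\` B)) by [].
rewrite Rint_indic; last exact: mp.
rewrite -lee_fin fineK; last by rewrite fin_num_measure//; exact: mp.
have [mup _] := p_iso; rewrite mup//; apply: le_trans nuUF.
apply: le_measure; rewrite ?inE//; last exact: setDS.
by apply: measurableD => //; exact: closed_borel.
Qed.

(** Up to [1 / N], the function [f] is the mean of the indicators of its
    superlevel sets [k < N * f], to which the case of indicators applies. *)
Lemma unit_continuous_lift (f : X -> R) (e : R) : compact [set: X] ->
  continuous f -> (forall x, 0 <= f x <= 1) -> 0 < e ->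
  exists2 h : Z -> R, continuous h & \int[mu]_x `|f x - h (p x)| <= e.
Proof.
move=> X_compact cf f01 e0; have e2 : 0 < e / 2 by exact: divr_gt0.
have [n ne] : exists n, (e / 2)^-1 <= n.+1%:R.
  have [n _ /(_ n (leqnn n)) /= nP] := nbhs_infty_ger (e / 2)^-1.
  by exists n; rewrite (le_trans nP)// ler_nat.
set N := n.+1 in ne *.
have N0 : 0 < N%:R :> R by rewrite ltr0n.
pose A k : set (borel X) := [set x | k%:R < N%:R * f x].
have mA k : measurable (A k).
  apply: open_borel.
  apply: (@open_comp _ _ (fun x => N%:R * f x) [set y | k%:R < y]);
    last exact: open_gt.
  by move=> x _; apply: cvgM; [exact: cvg_cst|exact: cf].
have /choice[h hP] k : exists h : Z -> R, continuous h /\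
    \int[mu]_x `|\1_(A k) x - h (p x)| <= e / 2.
  by have [h ? ?] := indic_continuous_lift (mA k) e2; exists h.
have ch k : continuous (h k) by case: (hP k).
have chs : continuous (fun z => N%:R^-1 * \sum_(k < N) h k z).
  by move=> z; apply: cvgM;
    [exact: cvg_cst|exact: (@continuous_sum_ord R Z h N ch)].
exists (fun z => N%:R^-1 * \sum_(k < N) h k z) => //.
have chp g : continuous g -> @bounded_measurable _ (borel X) R (fun x => g (p
  x)).
  move=> cg; apply: continuous_bounded_measurable => // x.
  by apply: continuous_comp; [exact: p_cts|exact: cg].
have bf : @bounded_measurable _ (borel X) R f by exact:
  continuous_bounded_measurable.
have bAh k : @bounded_measurable _ (borel X) R (fun x => `|\1_(A k) x - h k (p
  x)|).
  apply/bounded_measurable_norm/bounded_measurableB; last exact: chp.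
  exact: bounded_measurable_indic.
have bs : @bounded_measurable _ (borel X) R
    (fun x => N%:R^-1 * \sum_(k < N) `|\1_(A k) x - h k (p x)|).
  by apply: bounded_measurableM; exact: bounded_measurable_sum.
apply: (@le_trans _ _ (\int[mu]_x (e / 2 +
    N%:R^-1 * \sum_(k < N) `|\1_(A k) x - h k (p x)|))).
  apply: le_Rint => [||x].
  - by apply/bounded_measurable_norm/bounded_measurableB => //;
    exact: (chp _ chs).
  - by apply: bounded_measurableD => //; exact: bounded_measurable_cst.
  - rewrite -(subrKA (N%:R^-1 * \sum_(k < N) \1_(A k) x)).
    rewrite (le_trans (ler_normD _ _))// lerD//; last first.
      rewrite -mulrBr -sumrB normrM ger0_norm ?invr_ge0//.
      by rewrite ler_wpM2l ?invr_ge0// ler_norm_sum.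
    have /andP[f0 f1] := f01 x.
    have -> : \sum_(k < N) \1_(A k) x = \sum_(k < N) (k%:R < N%:R * f x)%R%:R
      :> R.
      apply: eq_bigr => k _; rewrite indicE; congr (_%:R).
      by apply: congr1; apply/idP/idP; rewrite inE.
    have /(count_below N)/andP[] : 0 <= N%:R * f x by rewrite mulr_ge0.
    rewrite (min_idPr _); last by rewrite ler_piMr.
    rewrite le_min => s1 /andP[_ s2].
    have Nf : f x = N%:R^-1 * (N%:R * f x) by rewrite mulKf// lt0r_neq0.
    rewrite {1}Nf -mulrBr normrM gtr0_norm ?invr_gt0// mulrC ler_pdivrMr//.
    rewrite distrC ger0_norm ?subr_ge0// lerBlDl (le_trans s2)// lerD2l.
    by rewrite -ler_pdivrMl// mulr1.
rewrite RintD//; last exact: bounded_measurable_cst.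
rewrite Rint_cst RintM; last exact: bounded_measurable_sum.
rewrite Rint_sum// [leRHS](splitr e) lerD2l mulrC ler_pdivrMr// mulrC.
rewrite mulr_natl -[X in _ *+ X](card_ord N) -sumr_const.
by apply: ler_sum => k _; case: (hP k).
Qed.

Lemma continuous_lift (f : X -> R) (D e : R) : compact [set: X] ->
  continuous f -> 0 < D -> (forall x, 0 <= f x <= D) -> 0 < e ->
  exists2 h : Z -> R, continuous h & \int[mu]_x `|f x - h (p x)| <= e.
Proof.
move=> X_compact cf D0 f01 e0.
pose g x := D^-1 * f x.
have cg : continuous g by move=> x; apply: cvgM; [exact: cvg_cst|exact: cf].
have [||h ch hP] := @unit_continuous_lift g (e / D) X_compact cg.
- move=> x; have /andP[f0 f1] := f01 x.
  rewrite /g; apply/andP; split; first by rewrite mulr_ge0// invr_ge0 ltW.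
  by rewrite mulrC ler_pdivrMr// mul1r.
- exact: divr_gt0.
have cDh : continuous (fun z => D * h z).
  by move=> z; apply: cvgM; [exact: cvg_cst|exact: ch].
exists (fun z => D * h z) => //.
have -> : (fun x => `|f x - D * h (p x)|) = (fun x => D * `|g x - h (p x)|).
  apply/funext => x; rewrite -{2}(gtr0_norm D0) -normrM mulrBr /g mulrA.
  by rewrite divff ?lt0r_neq0// mul1r.
rewrite RintM; first by rewrite mulrC -ler_pdivlMr.
apply/bounded_measurable_norm/bounded_measurableB.
  exact: continuous_bounded_measurable.
apply: continuous_bounded_measurable => // x.
by apply: continuous_comp; [exact: p_cts|exact: ch].
Qed.

End continuous_lifts.

Section isomorphic_extension_weyl.
Context (R : realType) (X Z : pmetricType R) (T : homeo X) (S : homeo Z).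
Hypothesis X_compact : compact [set: X].
Hypothesis Z_compact : compact [set: Z].
Hypothesis S_eq : equicontinuous_system S.

(** With [y j] a finite [c]-net, the distance of [u] and [v] is at most [2 * c]
    plus the sum of the [`|mdist (y j) u - mdist (y j) v|]. Each [mdist (y j)]
    is close in mean to a continuous function of [p]. The defect [G] has small
    averages over all long windows, uniformly, by unique ergodicity; and along
    the orbits of [p u] and [p v] the continuous functions stay close, by
    equicontinuity of [S]. *)
Lemma isomorphic_extension_weyl : isomorphic_extension T S ->
  weyl_mean_equicontinuous T.
Proof.
move=> [mu [nu [mu_unique nu_unique [p pf p_iso]]]] e e0.
have p_cts : continuous p by case: pf.
(* The final estimate adds five terms of size [c] and must stay below [e]. *)
pose c := e / 6; have c0 : 0 < c by exact: divr_gt0.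
have [D D0 DP] := mdist_bounded X_compact.
have [J [y yP]] := compact_net X_compact c0.
pose b := c / J.+1%:R; have b0 : 0 < b by rewrite divr_gt0// ltr0n.
have Jb : J%:R * b < c.
  by rewrite /b mulrCA gtr_pMr// ltr_pdivrMr ?ltr0n// mul1r ltr_nat.
have cy j : continuous (mdist (y j)).
  exact: (lipschitz_with_continuous (@lipschitz_with_mdist _ _ (y j))).
have /choice[h hP] j : exists h : Z -> R, continuous h /\
    \int[mu]_x `|mdist (y j) x - h (p x)| <= b.
  have [|h ? ?] := @continuous_lift _ _ _ _ _ _ p_cts p_iso _ D b X_compact (cy
    j) D0 _ b0.
    by move=> x; rewrite mdist_ge0 DP.
  by exists h.
have ch j : continuous (h j) by case: (hP j).
pose g j x := `|mdist (y j) x - h j (p x)|.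
have cg j : continuous (g j).
  move=> x; apply: cvg_norm; apply: cvgB; first exact: cy.
  by apply: continuous_comp; [exact: p_cts|exact: ch].
pose G x := \sum_(j < J) g j x.
have cG : continuous G by exact: (@continuous_sum_ord R X g J cg).
have GI : \int[mu]_x G x < c.
  rewrite /G Rint_sum; last by move=> j; exact: continuous_bounded_measurable.
  apply: le_lt_trans Jb;
    rewrite mulr_natl -[X in _ *+ X](card_ord J) -sumr_const.
  by apply: ler_sum => j _; case: (hP j).
have [N NP] := uniform_avg X_compact mu_unique cG GI.
have [d d0 dP] : exists2 d : R, 0 < d & forall u v, mdist u v < d ->
    forall (j : 'I_J) n, `|h j (p (iter n T u)) - h j (p (iter n T v))| < b.
  apply: (@heine_relation _ _ X_compact (fun e u v => forall (j : 'I_J) n,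
    `|h j (p (iter n T u)) - h j (p (iter n T v))| < e)) => //.
  - by move=> ? u v uv j n; rewrite distrC.
  - move=> ? u v w uv vw j n;
    rewrite (le_lt_trans (ler_distD (h j (p (iter n T v))) _ _))//.
    exact: ltrD.
  - move=> a u a0; apply/near_mdistP; apply: filter_forall => j.
    have [k k0 kP] := heine_real Z_compact (ch j) a0.
    have [k' k'0 k'P] := equicontinuous_uniform Z_compact S_eq k0.
    move/continuous_mdistP : p_cts => /(_ u _ k'0)[d d0 dP].
    apply/near_mdistP; exists d => // v uv n.
    by rewrite !(factor_iter pf); apply: kP; apply: k'P; exact: dP.
exists d => // u v uv.
apply: (@le_lt_trans _ _ (5 * c)%:E); last by rewrite lte_fin /c; lra.
apply: (@weyl_le _ _ _ _ _ _ N) => m n mn Nmn.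
have nm0 : (0 < n - m)%N by rewrite subn_gt0.
have point_bound i : mdist (iter i T (iter m T u)) (iter i T (iter m T v)) <=
    3 * c + G (iter i T (iter m T u)) + G (iter i T (iter m T v)).
  rewrite -!iterD; set u' := iter _ T u; set v' := iter _ T v.
  have [j0 j0J yj0] := yP u'.
  have fuv : mdist u' v' <= 2 * c +
      \sum_(j < J) `|mdist (y j) u' - mdist (y j) v'|.
    rewrite (bigD1 (Ordinal j0J))//=.
    have s0 : 0 <= \sum_(j < J | j != Ordinal j0J)
        `|mdist (y j) u' - mdist (y j) v'| by exact: sumr_ge0.
    have := metric_triangle u' (y j0) v'; rewrite (metric_sym u' (y j0)).
    have := ler_norm (mdist (y j0) v' - mdist (y j0) u'); rewrite distrC.
    by move: s0 yj0; lra.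
  apply: le_trans fuv _.
  have hs : \sum_(j < J) `|mdist (y j) u' - mdist (y j) v'| <=
      \sum_(j < J) (g j u' + b + g j v').
    apply: ler_sum => j _; rewrite /g.
    have := dP u v uv j (i + m)%N; rewrite -/u' -/v' => /ltW huv.
    have := ler_distD (h j (p u')) (mdist (y j) u') (mdist (y j) v').
    have := ler_distD (h j (p v')) (h j (p u')) (mdist (y j) v').
    by rewrite [X in _ <= _ + X -> _]distrC; move: huv; lra.
  have : \sum_(j < J) (g j u' + b + g j v') = G u' + J%:R * b + G v'.
    by rewrite !big_split/= sumr_const card_ord mulr_natl.
  by move: hs Jb; lra.
have mdE : mean_dist T u v m n = (n - m)%:R^-1 *
    \sum_(i < n - m) mdist (iter i T (iter m T u)) (iter i T (iter m T v)).
  rewrite /mean_dist -[X in index_iota X _]add0n big_addn big_mkord.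
  by under eq_bigr do rewrite !iterD.
have sum_bound : mean_dist T u v m n <=
    3 * c + avg T G (n - m) (iter m T u) + avg T G (n - m) (iter m T v).
  rewrite mdE -[3 * c](@avg_cst R X T _ (n - m) u nm0) /avg -!mulrDr
    -!big_split/=.
  rewrite ler_wpM2l ?invr_ge0//; apply: ler_sum => i _.
  exact: point_bound.
have := NP _ (iter m T u) Nmn; have := NP _ (iter m T v) Nmn.
by move: sum_bound; lra.
Qed.

End isomorphic_extension_weyl.

(** * The equivalence *)

Theorem theorem2p1 (R : realType) (X Z : pmetricType R)
    (T : homeo X) (S : homeo Z)
    (X_infinite : infinite_set [set: X])
    (X_compact : compact [set: X])
    (T_minimal : minimal T)
    (Z_max_equicontinuous : maximal_equicontinuous_factor T S) :
  [<-> mean_equicontinuous T;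
       weyl_mean_equicontinuous T;
       isomorphic_extension T S].
Proof.
have isom : mean_equicontinuous T -> isomorphic_extension T S.
  exact: mean_equicontinuous_isomorphic_extension.
have weyl : isomorphic_extension T S -> weyl_mean_equicontinuous T.
  case: Z_max_equicontinuous => Z_compact S_equicontinuous _.
  exact: isomorphic_extension_weyl.
have mean := @weyl_mean_equicontinuous_mean R X T.
by tfae => [/isom/weyl|/mean/isom|/weyl/mean].
Qed.
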